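(* Let $k\geq 3$ be an integer and let $\alpha\in(0,1]$. Suppose there is a polynomial-time $\alpha$-approximation algorithm for metric TSP (i.e., an algorithm that, on every metric graph, outputs a Hamiltonian cycle of weight at least $\alpha$ times the maximum weight of a Hamiltonian cycle). Then there is a polynomial-time $\alpha\cdot(1-0.5/k)(1-1/k)$-approximation algorithm for metric $k$CP.
   Context: A metric graph is an undirected complete graph $G=(V,E)$ on $n$ vertices with a non-negative edge weight function $w$ satisfying the triangle inequality; for an edge set $Y$, $w(Y)=\sum_{e\in Y}w(e)$. Metric TSP here is the maximization problem: find a maximum weight Hamiltonian cycle. A $k$-cycle is a simple cycle on exactly $k$ distinct vertices. When $k$ divides $n$, a $k$-cycle packing is a set of $n/k$ vertex-disjoint $k$-cycles covering all vertices. Metric $k$CP: given a metric graph with $n$ divisible by $k$, find a $k$-cycle packing of maximum total weight. A $\rho$-approximation algorithm outputs on every instance a feasible solution of weight at least $\rho$ times the optimum. *)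

(* Defs.v *)
From HB Require Import structures.
From mathcomp Require Import all_boot all_order all_algebra.
From mathcomp Require Import reals.

Set Implicit Arguments.
Unset Strict Implicit.
Unset Printing Implicit Defensive.

Import Order.TTheory GRing.Theory Num.Theory.

(* Model of computation: the WHILE language over binary trees of N. D. Jones
   (Computability and Complexity from a Programming Perspective, MIT Press,
   1997), with unit cost per elementary operation. Trees are shared, so a run of
   t steps allocates at most t cells; hence a deterministic Turing machine
   simulates it with polynomial overhead, and conversely. Polynomial time in
   this model is the usual polynomial time, provided that the unfolded output
   has polynomial size; this holds below, where outputs encode vertex
   sequences without repetition. *)

Inductive tree : Type := Leaf | Node of tree & tree.

Fixpoint tree_size (d : tree) : nat :=
  if d is Node d1 d2 then (tree_size d1 + tree_size d2).+1 else 1.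

Definition tree_hd (d : tree) : tree := if d is Node d1 _ then d1 else Leaf.
Definition tree_tl (d : tree) : tree := if d is Node _ d2 then d2 else Leaf.
Definition tree_test (d : tree) : bool := if d is Node _ _ then true else false.

Inductive expr : Type :=
  | EVar of nat
  | ENil
  | ECons of expr & expr
  | EHd of expr
  | ETl of expr.

Inductive cmd : Type :=
  | CAssign of nat & expr
  | CSeq of cmd & cmd
  | CIf of expr & cmd & cmd
  | CWhile of expr & cmd.

Definition store : Type := nat -> tree.

Definition update (s : store) (x : nat) (d : tree) : store :=
  fun y => if y == x then d else s y.

Fixpoint eval (s : store) (e : expr) : tree :=
  match e with
  | EVar x => s x
  | ENil => Leaf
  | ECons e1 e2 => Node (eval s e1) (eval s e2)
  | EHd e1 => tree_hd (eval s e1)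
  | ETl e1 => tree_tl (eval s e1)
  end.

Fixpoint expr_cost (e : expr) : nat :=
  match e with
  | EVar _ | ENil => 1
  | ECons e1 e2 => (expr_cost e1 + expr_cost e2).+1
  | EHd e1 | ETl e1 => (expr_cost e1).+1
  end.

(* [exec c s s' t]: started in store s, command c halts in store s' after
   exactly t steps. *)
Inductive exec : cmd -> store -> store -> nat -> Prop :=
  | ExecAssign x e s :
      exec (CAssign x e) s (update s x (eval s e)) (expr_cost e).+1
  | ExecSeq c1 c2 s s1 s2 t1 t2 :
      exec c1 s s1 t1 -> exec c2 s1 s2 t2 ->
      exec (CSeq c1 c2) s s2 (t1 + t2)
  | ExecIfTrue e c1 c2 s s1 t :
      tree_test (eval s e) -> exec c1 s s1 t ->
      exec (CIf e c1 c2) s s1 ((expr_cost e).+1 + t)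
  | ExecIfFalse e c1 c2 s s1 t :
      ~~ tree_test (eval s e) -> exec c2 s s1 t ->
      exec (CIf e c1 c2) s s1 ((expr_cost e).+1 + t)
  | ExecWhileTrue e c s s1 s2 t1 t2 :
      tree_test (eval s e) -> exec c s s1 t1 -> exec (CWhile e c) s1 s2 t2 ->
      exec (CWhile e c) s s2 ((expr_cost e).+1 + t1 + t2)
  | ExecWhileFalse e c s :
      ~~ tree_test (eval s e) ->
      exec (CWhile e c) s s (expr_cost e).+1.

(* Variable 0 holds the input initially and the output finally; every other
   variable is initially Leaf. *)
Definition init_store (d : tree) : store := update (fun=> Leaf) 0 d.

Definition runs (c : cmd) (input output : tree) (t : nat) : Prop :=
  exists s : store, exec c (init_store input) s t /\ s 0 = output.

Definition enc_seq (T : Type) (enc : T -> tree) (s : seq T) : tree :=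
  foldr (fun x d => Node (enc x) d) Leaf s.

Definition enc_bool (b : bool) : tree := if b then Node Leaf Leaf else Leaf.

(* Binary digits, least significant first, without leading zeros. The fuel n
   suffices because halving n at most n times reaches 0. *)
Fixpoint bits_rec (fuel n : nat) : seq bool :=
  if fuel is fuel'.+1 then
    if n == 0 then [::] else odd n :: bits_rec fuel' n./2
  else [::].

Definition bits (n : nat) : seq bool := bits_rec n n.

Definition enc_binary (n : nat) : tree := enc_seq enc_bool (bits n).

Definition enc_unary (n : nat) : tree := iter n (Node Leaf) Leaf.

(* Only used on nonnegative rationals, so no sign is recorded. *)
Definition enc_rat (q : rat) : tree :=
  Node (enc_binary `|numq q|) (enc_binary `|denq q|).

(* The loops (i, i) are not edges; giving them weight 0 makes the weight matrix
   determined by the edge weights, and makes the degenerate instances of the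
   triangle inequality hold automatically. Weights are rational because they
   are part of the input of an algorithm. *)
Record metric_graph : Type := MetricGraph {
  nverts : nat;
  weight : 'I_nverts -> 'I_nverts -> rat;
  weight_ge0 : forall i j, (0 <= weight i j)%R;
  weight_sym : forall i j, weight i j = weight j i;
  weight_diag : forall i, weight i i = 0%R;
  weight_triangle :
    forall i j l, (weight i l <= weight i j + weight j l)%R
}.

Definition enc_graph (G : metric_graph) : tree :=
  enc_seq (fun i => enc_seq (fun j => enc_rat (weight i j))
                            (enum 'I_(nverts G)))
          (enum 'I_(nverts G)).

(* A simple cycle is given by its vertices in cyclic order; the graph being
   complete, consecutive distinct vertices are always adjacent. *)
Definition k_cycle (n k : nat) (c : seq 'I_n) : bool :=
  [&& 3 <= k, uniq c & size c == k].

Definition cycle_weight (G : metric_graph) (c : seq 'I_(nverts G)) : rat :=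
  (\sum_(x <- c) weight x (next c x))%R.

Definition hamiltonian_cycle (n : nat) (c : seq 'I_n) : bool := k_cycle n c.

Definition k_cycle_packing (n k : nat) (P : seq (seq 'I_n)) : Prop :=
  [/\ size P = n %/ k,
      all (k_cycle k) P,
      uniq (flatten P)
    & forall x : 'I_n, x \in flatten P].

Definition packing_weight (G : metric_graph) (P : seq (seq 'I_(nverts G))) :
  rat := (\sum_(c <- P) cycle_weight c)%R.

(* Vertices may be written in unary: their number is at most the size of the
   weight matrix. *)
Definition enc_cycle (n : nat) (c : seq 'I_n) : tree :=
  enc_seq (fun i : 'I_n => enc_unary i) c.

Definition enc_packing (n : nat) (P : seq (seq 'I_n)) : tree :=
  enc_seq (@enc_cycle n) P.

Record max_problem : Type := MaxProblem {
  instance : Type;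
  admissible : instance -> Prop;
  enc_instance : instance -> tree;
  solution : instance -> Type;
  enc_solution : forall x : instance, solution x -> tree;
  feasible : forall x : instance, solution x -> Prop;
  value : forall x : instance, solution x -> rat
}.

(* Graphs with fewer than 3 vertices have no Hamiltonian cycle. *)
Definition metric_TSP : max_problem :=
  {| instance := metric_graph;
     admissible := fun G => 3 <= nverts G;
     enc_instance := enc_graph;
     solution := fun G => seq 'I_(nverts G);
     enc_solution := fun G c => enc_cycle c;
     feasible := fun G c => hamiltonian_cycle c;
     value := fun G c => cycle_weight c |}.

Definition metric_kCP (k : nat) : max_problem :=
  {| instance := metric_graph;
     admissible := fun G => k %| nverts G;
     enc_instance := enc_graph;
     solution := fun G => seq (seq 'I_(nverts G));
     enc_solution := fun G P => enc_packing P;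
     feasible := fun G P => k_cycle_packing k P;
     value := fun G P => packing_weight P |}.

Definition has_polytime_approx (R : realType) (rho : R) (Pb : max_problem) :
  Prop :=
  exists (c : cmd) (p : {poly nat}),
    forall x : instance Pb, admissible x ->
    exists (y : solution x) (t : nat),
      [/\ runs c (enc_instance x) (enc_solution y) t,
          t <= p.[tree_size (enc_instance x)]%R,
          feasible y
        & forall y' : solution x, feasible y' ->
            (rho * ratr (value y') <= ratr (value y))%R].

(* Main.v *)
(* Let H be a Hamiltonian cycle. Deleting every k-th edge of H leaves n/k paths
   on k vertices; each edge is deleted for exactly one of the k possible offsets,
   so for the best offset the paths keep at least (1 - 1/k) w(H), and closing them
   into cycles does not decrease the weight. Conversely, delete the lightest edge
   of every cycle of a k-cycle packing and concatenate the resulting paths,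
   starting from the path whose deleted edge is lightest. By the triangle
   inequality one of the two ends of the next path is at distance at least half
   of its deleted edge from the current end, so the connections win back half of
   the deleted weight: some Hamiltonian cycle has weight at least (1 - 0.5/k)
   times that of the packing.

   Choosing the best offset requires exact rational arithmetic on binary
   numbers. Running times are controlled through a class of functions on trees,
   computable in polynomial time with outputs of polynomial size, closed under
   composition, pairing, branching and iteration with polynomially bounded
   intermediate states. *)

Require Import Defs.
From mathcomp Require Import all_boot all_order all_algebra.
From mathcomp Require Import reals.
From mathcomp Require Import zify lra.

Set Implicit Arguments.
Unset Strict Implicit.
Unset Printing Implicit Defensive.

Import Order.TTheory GRing.Theory Num.Theory.

(** * Polynomial time *)

Lemma tree_size_gt0 d : 0 < tree_size d.
Proof. by case: d. Qed.

Lemma tree_size_hd d : tree_size (tree_hd d) <= tree_size d.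
Proof. by case: d => //= a b; lia. Qed.

Lemma tree_size_tl d : tree_size (tree_tl d) <= tree_size d.
Proof. by case: d => //= a b; lia. Qed.

(** The base is at least 2 because trees have positive size, so a single exponent absorbs constants
    and sums. *)
Definition poly_bounded (f : tree -> nat) : Prop :=
  exists b, forall d, f d <= (tree_size d).+1 ^ b.

Lemma poly_bounded_le f g :
  (forall d, f d <= g d) -> poly_bounded g -> poly_bounded f.
Proof. by move=> le_fg [b hb]; exists b => d; apply: leq_trans (hb d). Qed.

Lemma poly_bounded_const n : poly_bounded (fun=> n).
Proof.
exists n => d; apply: leq_trans (ltnW (ltn_expl n (ltnSn 1))) _.
by case: n => // n; rewrite leq_exp2r // ltnS tree_size_gt0.
Qed.

Lemma poly_bounded_size : poly_bounded tree_size.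
Proof. by exists 1 => d; rewrite expn1. Qed.

Lemma poly_bounded_mul f g :
  poly_bounded f -> poly_bounded g -> poly_bounded (fun d => f d * g d).
Proof.
move=> [a ha] [b hb]; exists (a + b) => d.
by rewrite expnD leq_mul.
Qed.

Lemma poly_bounded_add f g :
  poly_bounded f -> poly_bounded g -> poly_bounded (fun d => f d + g d).
Proof.
move=> [a ha] [b hb]; exists (a + b).+1 => d.
have x_gt1 : 1 < (tree_size d).+1 by have := tree_size_gt0 d; lia.
have le1 : (tree_size d).+1 ^ a <= (tree_size d).+1 ^ (a + b).
  by rewrite leq_exp2l // leq_addr.
have le2 : (tree_size d).+1 ^ b <= (tree_size d).+1 ^ (a + b).
  by rewrite leq_exp2l // leq_addl.
rewrite expnS; apply: leq_trans (leq_mul x_gt1 (leqnn _)).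
by have := ha d; have := hb d; lia.
Qed.

Lemma poly_bounded_exp f b :
  poly_bounded f -> poly_bounded (fun d => f d ^ b).
Proof.
move=> hf; elim: b => [|b ih]; first exact: poly_bounded_const 1.
apply: poly_bounded_le (poly_bounded_mul hf ih) => d.
by rewrite expnS.
Qed.

Lemma poly_bounded_comp f g :
  poly_bounded f -> poly_bounded (fun d => tree_size (g d)) ->
  poly_bounded (fun d => f (g d)).
Proof.
move=> [a ha] hg.
apply: poly_bounded_le (_ : poly_bounded (fun d => (tree_size (g d) + 1) ^ a)).
  by move=> d; rewrite addn1.
by apply: poly_bounded_exp; apply: poly_bounded_add hg (poly_bounded_const 1).
Qed.

Lemma poly_bounded_hd f :
  poly_bounded (fun d => tree_size (f d)) ->
  poly_bounded (fun d => tree_size (tree_hd (f d))).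
Proof. by apply: poly_bounded_le => d; apply: tree_size_hd. Qed.

Lemma poly_bounded_tl f :
  poly_bounded (fun d => tree_size (f d)) ->
  poly_bounded (fun d => tree_size (tree_tl (f d))).
Proof. by apply: poly_bounded_le => d; apply: tree_size_tl. Qed.

(* Every such program initialises the variables it reads, except variable 0, and
   leaves the variables from [m] on untouched; hence programs can be chained
   and can keep data in fresh variables without any cleaning up. *)
Definition computes (c : cmd) (m : nat) (f : tree -> tree) (T : tree -> nat) :
  Prop :=
  forall s, exists s' t,
    [/\ exec c s s' t, t <= T (s 0), s' 0 = f (s 0)
      & forall x, m <= x -> s' x = s x].

(** One assignment can double a tree by sharing, so a short run may leave a tree of exponential
    size; the separate output bound is what makes composition work. [0 < m] keeps variable 0 out of
    the preserved variables. *)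
Definition ptime (f : tree -> tree) : Prop :=
  poly_bounded (fun d => tree_size (f d)) /\
  exists c m T, [/\ 0 < m, poly_bounded T & computes c m f T].

Lemma eq_ptime f g : f =1 g -> ptime f -> ptime g.
Proof.
move=> fg [hf [c [m [T [m0 hT hc]]]]]; split.
  by apply: poly_bounded_le hf => d; rewrite fg.
by exists c, m, T; split=> // s; rewrite -fg; apply: hc.
Qed.

Lemma ptime_expr e :
  poly_bounded (fun d => tree_size (eval (fun=> d) e)) ->
  (forall s, eval s e = eval (fun=> s 0) e) ->
  ptime (fun d => eval (fun=> d) e).
Proof.
move=> he h0; split=> //.
exists (CAssign 0 e), 1, (fun=> (expr_cost e).+1); split=> //.
  exact: poly_bounded_const.
move=> s; exists (update s 0 (eval s e)), (expr_cost e).+1; split=> //.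
- exact: ExecAssign.
- by rewrite /update eqxx h0.
- by move=> [|x].
Qed.

Lemma ptime_id : ptime id.
Proof. exact: (@ptime_expr (EVar 0)) poly_bounded_size _. Qed.

Lemma ptime_const_leaf : ptime (fun=> Leaf).
Proof. exact: (@ptime_expr ENil) (poly_bounded_const 1) _. Qed.

Lemma ptime_comp f g : ptime f -> ptime g -> ptime (fun d => f (g d)).
Proof.
move=> [hf [c1 [m1 [T1 [m10 hT1 hc1]]]]] [hg [c2 [m2 [T2 [m20 hT2 hc2]]]]].
split; first exact: (poly_bounded_comp hf hg).
exists (CSeq c2 c1), (maxn m1 m2), (fun d => T2 d + T1 (g d)); split.
- by rewrite leq_max m10.
- exact: poly_bounded_add hT2 (poly_bounded_comp hT1 hg).
move=> s; have [s1 [t1 [e1 le1 v1 f1]]] := hc2 s.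
have [s2 [t2 [e2 le2 v2 f2]]] := hc1 s1.
exists s2, (t1 + t2); split.
- exact: ExecSeq e1 e2.
- by rewrite leq_add // -v1.
- by rewrite v2 v1.
- by move=> x; rewrite geq_max => /andP[h1 h2]; rewrite f2 // f1.
Qed.

Lemma ptime_hd f : ptime f -> ptime (fun d => tree_hd (f d)).
Proof.
apply: ptime_comp; apply: (@ptime_expr (EHd (EVar 0))) => //.
exact: poly_bounded_hd poly_bounded_size.
Qed.

Lemma ptime_tl f : ptime f -> ptime (fun d => tree_tl (f d)).
Proof.
apply: ptime_comp; apply: (@ptime_expr (ETl (EVar 0))) => //.
exact: poly_bounded_tl poly_bounded_size.
Qed.

Lemma poly_bounded_node f g :
  poly_bounded (fun d => tree_size (f d)) ->
  poly_bounded (fun d => tree_size (g d)) ->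
  poly_bounded (fun d => tree_size (Node (f d) (g d))).
Proof.
move=> hf hg.
apply: poly_bounded_le (poly_bounded_add (poly_bounded_const 1)
  (poly_bounded_add hf hg)) => d /=; lia.
Qed.

Lemma updateE s x d y : update s x d y = if y == x then d else s y.
Proof. by []. Qed.

Lemma ptime_node f g : ptime f -> ptime g -> ptime (fun d => Node (f d) (g d)).
Proof.
move=> [hf [c1 [m1 [T1 [m10 hT1 hc1]]]]] [hg [c2 [m2 [T2 [m20 hT2 hc2]]]]].
split; first exact: poly_bounded_node.
pose M := maxn m1 m2.
have le_m1 : m1 <= M by rewrite leq_maxl.
have le_m2 : m2 <= M by rewrite leq_maxr.
(* [M] saves the input during [c1], and [M.+1] the first result during [c2]; both lie above
   everything that [c1] and [c2] change. *)
exists (CSeq (CAssign M (EVar 0)) (CSeq c1 (CSeq (CAssign M.+1 (EVar 0))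
         (CSeq (CAssign 0 (EVar M)) (CSeq c2
         (CAssign 0 (ECons (EVar M.+1) (EVar 0)))))))),
  M.+2, (fun d => 10 + (T1 d + T2 d)); split=> //.
  apply: poly_bounded_add (poly_bounded_const _) _.
  exact: poly_bounded_add.
move=> s.
have [s1 [t1 [e1 le1 v1 f1]]] := hc1 (update s M (s 0)).
pose s2 := update s1 M.+1 (s1 0); pose s3 := update s2 0 (s2 M).
have [s4 [t2 [e2 le2 v2 f2]]] := hc2 s3.
have M0 : (0 == M) = false by lia.
have M1 : (M == M.+1) = false by lia.
have M2 : (M.+1 == M) = false by lia.
rewrite /update M0 in le1 v1.
have s2M : s2 M = s 0 by rewrite /s2 !updateE M1 f1 // updateE eqxx.
have s30 : s3 0 = s 0 by rewrite /s3 updateE.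
rewrite s30 in le2 v2.
exists (update s4 0 (Node (s4 M.+1) (s4 0))), (2 + (t1 + (2 + (2 + (t2 + 4))))).
split.
- apply: ExecSeq (ExecAssign M (EVar 0) s) _.
  apply: ExecSeq e1 _.
  apply: ExecSeq (ExecAssign M.+1 (EVar 0) s1) _.
  apply: ExecSeq (ExecAssign 0 (EVar M) s2) _.
  apply: ExecSeq e2 _.
  exact: ExecAssign 0 (ECons (EVar M.+1) (EVar 0)) s4.
- by lia.
- rewrite updateE eqxx v2 f2; last by lia.
  by rewrite /s3 /s2 /update /= eqxx v1.
- move=> x hx; rewrite updateE; case: eqP => [|_]; first by lia.
  rewrite f2; last by lia.
  rewrite /s3 /s2 !updateE; case: eqP => [|_]; first by lia.
  case: eqP => [|_]; first by lia.
  rewrite f1 ?updateE; last by lia.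
  by case: eqP => [|_] //; lia.
Qed.

Lemma ptime_if b f g : ptime b -> ptime f -> ptime g ->
  ptime (fun d => if tree_test (b d) then f d else g d).
Proof.
move=> pb [hf [c1 [m1 [T1 [m10 hT1 hc1]]]]] [hg [c2 [m2 [T2 [m20 hT2 hc2]]]]].
split.
  apply: poly_bounded_le (poly_bounded_add hf hg) => d.
  by case: ifP => _; lia.
(* The test is computed in a pair with the input, so that the branches still find the input. *)
have [hp [c [m [T [m0 hT hc]]]]] := ptime_node pb ptime_id.
pose M := maxn m (maxn m1 m2).
have [le_m le_m1 le_m2] : [/\ m <= M, m1 <= M & m2 <= M].
  by split; rewrite /M; lia.
exists (CSeq c (CSeq (CAssign M (EHd (EVar 0)))
         (CSeq (CAssign 0 (ETl (EVar 0))) (CIf (EVar M) c1 c2)))),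
  M.+1, (fun d => T d + (8 + (T1 d + T2 d))); split=> //.
  apply: poly_bounded_add hT (poly_bounded_add (poly_bounded_const _) _).
  exact: poly_bounded_add.
move=> s; have [s1 [t [e1 le1 v1 f1]]] := hc s.
pose s2 := update s1 M (tree_hd (s1 0)).
pose s3 := update s2 0 (tree_tl (s2 0)).
have M0 : (0 == M) = false by lia.
have s30 : s3 0 = s 0 by rewrite /s3 updateE eqxx /s2 updateE M0 v1.
have s3M : s3 M = b (s 0) by rewrite /s3 updateE eq_sym M0 /s2 updateE eqxx v1.
have pre s' t' : exec (CIf (EVar M) c1 c2) s3 s' t' ->
  exec (CSeq c (CSeq (CAssign M (EHd (EVar 0)))
         (CSeq (CAssign 0 (ETl (EVar 0))) (CIf (EVar M) c1 c2))))
    s s' (t + (3 + (3 + t'))).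
  move=> e; apply: ExecSeq e1 _.
  apply: ExecSeq (ExecAssign M (EHd (EVar 0)) s1) _.
  exact: ExecSeq (ExecAssign 0 (ETl (EVar 0)) s2) e.
have frame x : M < x -> s3 x = s x.
  move=> hx; rewrite /s3 /s2 !updateE.
  by do 2![case: eqP => [|_]; first by lia]; rewrite f1 //; lia.
case hb: (tree_test (b (s 0))).
  have [s4 [t1 [e2 le2 v2 f2]]] := hc1 s3.
  exists s4, (t + (3 + (3 + (2 + t1)))); split.
  - by apply/pre/ExecIfTrue => //=; rewrite s3M.
  - by rewrite s30 in le2; lia.
  - by rewrite v2 s30.
  - by move=> x hx; rewrite f2 ?frame //; lia.
have [s4 [t1 [e2 le2 v2 f2]]] := hc2 s3.
exists s4, (t + (3 + (3 + (2 + t1)))); split.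
- by apply/pre/ExecIfFalse => //=; rewrite s3M hb.
- by rewrite s30 in le2; lia.
- by rewrite v2 s30.
- by move=> x hx; rewrite f2 ?frame //; lia.
Qed.

(** The length of a tree read as a list: it counts loop rounds and, for numbers, binary digits. *)
Fixpoint spine (d : tree) : nat := if d is Node _ d2 then (spine d2).+1 else 0.

Lemma spine_le_size d : spine d <= tree_size d.
Proof. by elim: d => //= a _ b; lia. Qed.

Lemma poly_bounded_spine f :
  poly_bounded (fun d => tree_size (f d)) ->
  poly_bounded (fun d => spine (f d)).
Proof. by apply: poly_bounded_le => d; apply: spine_le_size. Qed.

(* The bound [B] on the size of all intermediate states is what keeps iteration
   inside polynomial time. *)
Lemma ptime_iter (n init step : tree -> tree) (B : tree -> nat) :
  ptime n -> ptime init -> ptime step -> poly_bounded B ->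
  (forall d i, tree_size (iter i step (init d)) <= B d) ->
  ptime (fun d => iter (spine (n d)) step (init d)).
Proof.
move=> pn pinit [hst [c1 [m1 [T1 [m10 hT1 hc1]]]]] hB le_B.
split; first exact: poly_bounded_le hB.
have [hp [c [m [T [m0 hT hc]]]]] := ptime_node pn pinit.
have [b hb] := hT1.
pose M := maxn m m1.
have [le_m le_m1] : m <= M /\ m1 <= M by split; rewrite /M; lia.
pose K d := (B d + 1) ^ b.
(* [M] holds the counter list, which loses one cell per round; variable 0 holds the state. *)
pose W := CWhile (EVar M) (CSeq c1 (CAssign M (ETl (EVar M)))).
exists (CSeq c (CSeq (CAssign M (EHd (EVar 0)))
         (CSeq (CAssign 0 (ETl (EVar 0))) W))),
  M.+1, (fun d => T d + (8 + spine (n d) * (K d + 5))); split=> //.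
  apply: poly_bounded_add hT (poly_bounded_add (poly_bounded_const _) _).
  apply: poly_bounded_mul; first by apply: poly_bounded_spine; case: pn.
  apply: poly_bounded_add _ (poly_bounded_const _).
  exact: poly_bounded_exp (poly_bounded_add hB (poly_bounded_const _)).
move=> s; have [s1 [t [e1 le1 v1 f1]]] := hc s.
pose s2 := update s1 M (tree_hd (s1 0)).
pose s3 := update s2 0 (tree_tl (s2 0)).
have M0 : (0 == M) = false by lia.
have s30 : s3 0 = init (s 0) by rewrite /s3 updateE eqxx /s2 updateE M0 v1.
have s3M : s3 M = n (s 0) by rewrite /s3 updateE eq_sym M0 /s2 updateE eqxx v1.
(* The entry state is recorded as an iterate on [init d], because only for such states does [B]
   bound the size, and hence [K d] the cost of a round. *)
have loop d l : forall i s, s 0 = iter i step (init d) -> s M = l ->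
    exists s' t, [/\ exec W s s' t, t <= 2 + spine l * (K d + 5),
      s' 0 = iter (spine l) step (s 0) & forall x, M < x -> s' x = s x].
  elim: l => [|a _ l ih] i s0 s00 s0M.
    exists s0, 2; split=> //; apply: ExecWhileFalse.
    by rewrite /= s0M.
  have [s4 [t1 [e4 le4 v4 f4]]] := hc1 s0.
  pose s5 := update s4 M (tree_tl (s4 M)).
  have s50 : s5 0 = iter i.+1 step (init d).
    by rewrite /s5 updateE M0 v4 s00.
  have s5M : s5 M = l by rewrite /s5 updateE eqxx f4 // s0M.
  have [s6 [t2 [e6 le6 v6 f6]]] := ih _ _ s50 s5M.
  exists s6, (2 + (t1 + 3) + t2); split.
  - apply: (ExecWhileTrue (s1 := s5) (t1 := t1 + 3)) => //.
      by rewrite /= s0M.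
    exact: ExecSeq e4 (ExecAssign M (ETl (EVar M)) s4).
  - have : t1 <= K d.
      apply: leq_trans le4 (leq_trans (hb _) _); rewrite s00 /K addn1.
      by case: (b) => // b'; rewrite leq_exp2r // ltnS le_B.
    by rewrite /= mulSn; lia.
  - by rewrite v6 s50 /= s00 -iterSr.
  - move=> x hx; rewrite f6 // /s5 updateE; case: eqP => [|_]; first by lia.
    by rewrite f4 //; lia.
have [s4 [t1 [e4 le4 v4 f4]]] := loop (s 0) (n (s 0)) 0 s3 s30 s3M.
exists s4, (t + (3 + (3 + t1))); split.
- apply: ExecSeq e1 _.
  apply: ExecSeq (ExecAssign M (EHd (EVar 0)) s1) _.
  exact: ExecSeq (ExecAssign 0 (ETl (EVar 0)) s2) e4.
- by lia.
- by rewrite v4 s30.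
- move=> x hx; rewrite f4 // /s3 /s2 !updateE.
  by do 2![case: eqP => [|_]; first by lia]; rewrite f1 //; lia.
Qed.

(** * Replaying a run in another store *)

Fixpoint expr_bound (e : expr) : nat :=
  match e with
  | EVar x => x.+1
  | ENil => 0
  | ECons e1 e2 => maxn (expr_bound e1) (expr_bound e2)
  | EHd e1 | ETl e1 => expr_bound e1
  end.

Fixpoint cmd_bound (c : cmd) : nat :=
  match c with
  | CAssign x e => maxn x.+1 (expr_bound e)
  | CSeq c1 c2 => maxn (cmd_bound c1) (cmd_bound c2)
  | CIf e c1 c2 => maxn (expr_bound e) (maxn (cmd_bound c1) (cmd_bound c2))
  | CWhile e c1 => maxn (expr_bound e) (cmd_bound c1)
  end.

Lemma eq_eval s s' e :
  (forall x, x < expr_bound e -> s x = s' x) -> eval s e = eval s' e.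
Proof.
elim: e => //= [x h|e1 ih1 e2 ih2 h|e ih h|e ih h]; first exact: h.
- by rewrite ih1 ?ih2 // => x hx; apply: h; rewrite leq_max hx ?orbT.
- by rewrite ih.
- by rewrite ih.
Qed.

(** The given TSP program is specified only on [init_store]. As a run touches only variables below
    [cmd_bound], it can be replayed while other data sit above. *)
Lemma exec_frame m c s s' t : exec c s s' t -> cmd_bound c <= m ->
  forall r, (forall x, x < m -> s x = r x) ->
  exists r', [/\ exec c r r' t, forall x, x < m -> s' x = r' x
    & forall x, m <= x -> r' x = r x].
Proof.
elim=> {c s s' t} /=.
- move=> x e s; rewrite geq_max => /andP[xm em] r sr.
  exists (update r x (eval r e)); split.
  + exact: ExecAssign.
  + move=> y ym; rewrite !updateE; case: eqP => // _; last exact: sr.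
    by apply: eq_eval => z hz; apply: sr; lia.
  + by move=> y ym; rewrite updateE; case: eqP => //; lia.
- move=> c1 c2 s s1 s2 t1 t2 _ ih1 _ ih2; rewrite geq_max => /andP[m1 m2] r sr.
  have [r1 [e1 a1 f1]] := ih1 m1 _ sr; have [r2 [e2 a2 f2]] := ih2 m2 _ a1.
  exists r2; split=> //; first exact: ExecSeq e1 e2.
  by move=> x mx; rewrite f2 // f1.
- move=> e c1 c2 s s1 t he _ ih; rewrite !geq_max => /and3P[me m1 m2] r sr.
  have [r1 [e1 a1 f1]] := ih m1 _ sr; exists r1; split=> //.
  apply: ExecIfTrue => //; rewrite -(eq_eval (s := s)) // => x hx.
  by apply: sr; lia.
- move=> e c1 c2 s s1 t he _ ih; rewrite !geq_max => /and3P[me m1 m2] r sr.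
  have [r1 [e1 a1 f1]] := ih m2 _ sr; exists r1; split=> //.
  apply: ExecIfFalse => //; rewrite -(eq_eval (s := s)) // => x hx.
  by apply: sr; lia.
- move=> e c s s1 s2 t1 t2 he _ ih1 _ ih2 mc r sr.
  have /andP[me m1] : (expr_bound e <= m) && (cmd_bound c <= m).
    by rewrite -geq_max.
  have [r1 [e1 a1 f1]] := ih1 m1 _ sr; have [r2 [e2 a2 f2]] := ih2 mc _ a1.
  exists r2; split=> //; last by move=> x mx; rewrite f2 // f1.
  apply: ExecWhileTrue e1 e2; rewrite -(eq_eval (s := s)) // => x hx.
  by apply: sr; lia.
- move=> e c s he; rewrite geq_max => /andP[me mc] r sr; exists r; split=> //.
  apply: ExecWhileFalse; rewrite -(eq_eval (s := s)) // => x hx.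
  by apply: sr; lia.
Qed.

Lemma poly_bounded_horner (p : {poly nat}) :
  poly_bounded (fun d => (p.[tree_size d])%R).
Proof.
elim/poly_ind: p => [|p a ih].
  by apply: poly_bounded_le (poly_bounded_const 0) => d; rewrite horner0.
apply: poly_bounded_le (poly_bounded_add (poly_bounded_mul ih poly_bounded_size)
  (poly_bounded_const a)) => d.
by rewrite hornerMXaddC.
Qed.

(** Returns from power bounds to the polynomials that [has_polytime_approx] asks for. *)
Lemma poly_bounded_polyP (T : tree -> nat) : poly_bounded T ->
  exists p : {poly nat}, forall d, T d <= (p.[tree_size d])%R.
Proof.
move=> [b hb]; exists (('X + 1) ^+ b)%R => d; apply: leq_trans (hb d) _.
rewrite horner_exp hornerD hornerX hornerC.
by rewrite -addn1 -natrXE.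
Qed.

Lemma ptime_app2 F g h : ptime (fun d => F (tree_hd d) (tree_tl d)) ->
  ptime g -> ptime h -> ptime (fun d => F (g d) (h d)).
Proof. by move=> hF hg hh; apply: (ptime_comp hF (ptime_node hg hh)). Qed.

Definition tone := Node Leaf Leaf.

Lemma ptime_tone : ptime (fun=> tone).
Proof. exact: ptime_node ptime_const_leaf ptime_const_leaf. Qed.

Ltac ptime := repeat first
  [ assumption | exact: ptime_id | exact: ptime_const_leaf | exact: ptime_tone
  | apply: ptime_if | apply: ptime_hd | apply: ptime_tl | apply: ptime_node ].

Ltac poly_bound := repeat first
  [ exact: poly_bounded_size | exact: poly_bounded_const
  | apply: poly_bounded_add | apply: poly_bounded_mul
  | apply: poly_bounded_hd | apply: poly_bounded_tl ].

(** * Lists *)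

Fixpoint tcatrev (a b : tree) : tree :=
  if a is Node x a' then tcatrev a' (Node x b) else b.

Lemma size_tcatrev a b :
  tree_size (tcatrev a b) + 1 = tree_size a + tree_size b.
Proof. by elim: a b => [|x _ a ih] b /=; rewrite ?ih /=; lia. Qed.

Lemma spine_tcatrev a b : spine (tcatrev a b) = spine a + spine b.
Proof. by elim: a b => [|x _ a ih] b //=; rewrite ih /=; lia. Qed.

Lemma tcatrev_enc (T : Type) (enc : T -> tree) s1 s2 :
  tcatrev (enc_seq enc s1) (enc_seq enc s2) = enc_seq enc (catrev s1 s2).
Proof. by elim: s1 s2 => //= x s1 ih s2; rewrite -ih. Qed.

Definition catrev_step (s : tree) : tree :=
  if tree_test (tree_hd s) then
    Node (tree_tl (tree_hd s)) (Node (tree_hd (tree_hd s)) (tree_tl s))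
  else s.

Lemma iter_catrev a b :
  iter (spine a) catrev_step (Node a b) = Node Leaf (tcatrev a b).
Proof. by elim: a b => // x _ a ih b; rewrite [spine _]/= iterSr -ih. Qed.

Lemma ptime_catrev g h : ptime g -> ptime h ->
  ptime (fun d => tcatrev (g d) (h d)).
Proof.
apply: ptime_app2.
apply: (@eq_ptime (fun d => tree_tl (iter (spine (tree_hd d)) catrev_step
   (Node (tree_hd d) (tree_tl d))))) => [d|]; first by rewrite iter_catrev.
apply: ptime_tl.
apply: (ptime_iter (B := fun d => tree_size d + tree_size d + 1)); try by ptime.
- poly_bound.
(* A step only moves one cell from the first list to the second, so the total size never grows. *)
move=> d i.
have : tree_size (Node (tree_hd d) (tree_tl d)) <=
    tree_size d + tree_size d + 1.
  by have := tree_size_hd d; have := tree_size_tl d => /=; lia.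
apply: leq_trans; elim: i => // i ih; rewrite iterS; apply: leq_trans ih.
by case: (iter _ _ _) => [|[|x a] b] //=; rewrite /catrev_step /=; lia.
Qed.

Definition tdrop (u l : tree) : tree := iter (spine u) tree_tl l.

Lemma ptime_tdrop g h : ptime g -> ptime h ->
  ptime (fun d => tdrop (g d) (h d)).
Proof.
apply: ptime_app2.
apply: (ptime_iter (B := fun d => tree_size d)); try by ptime.
- poly_bound.
move=> d i; apply: leq_trans (tree_size_tl d).
by elim: i => // i; rewrite iterS; apply: leq_trans (tree_size_tl _).
Qed.

(** * Binary arithmetic *)

(* Least significant bit first; leading zeros are allowed, so equal numbers may
   be represented by different trees. *)
Fixpoint bval (d : tree) : nat :=
  if d is Node x r then tree_test x + 2 * bval r else 0.

(** The cells of [a] become the low digits in front of [b], which is thereby shifted by [spine a]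
    places. *)
Lemma bval_tcatrev a b :
  bval (tcatrev a b) = bval (tcatrev a Leaf) + 2 ^ spine a * bval b.
Proof.
elim: a b => [|x _ a ih] b //=; first by lia.
by rewrite ih [in RHS]ih /= expnS; lia.
Qed.

Lemma bval_enc_binary n : bval (enc_binary n) = n.
Proof.
have bitsE f m : m <= f -> bval (enc_seq enc_bool (bits_rec f m)) = m.
  elim: f m => [|f ih] m /=; first by case: m.
  case: eqP => [->//|m0] le_mf /=; have := odd_double_half m.
  rewrite -muln2 => hm; rewrite ih; last by lia.
  by case: (odd m) hm => /=; lia.
exact: bitsE.
Qed.

(** Together with [tmaj] this makes a full adder: a double [txor] is the sum digit, the majority is
    the carry. *)
Definition txor (x y : tree) : tree :=
  if tree_test x then (if tree_test y then Leaf else tone)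
  else (if tree_test y then tone else Leaf).

Definition tmaj (x y z : tree) : tree :=
  if tree_test x then (if tree_test y then tone else
                       if tree_test z then tone else Leaf)
  else (if tree_test y then (if tree_test z then tone else Leaf) else Leaf).

Definition tor (x y : tree) : tree := if tree_test x then tone else y.

(** The state consists of the unread digits [a], [b] of the summands, the carry [c], and the digits
    [r] of the sum so far, most significant first. It is a fixed point once [a], [b] and [c] are
    empty. *)
Definition add_step (s : tree) : tree :=
  let a := tree_hd (tree_hd s) in let b := tree_tl (tree_hd s) in
  let c := tree_hd (tree_tl s) in let r := tree_tl (tree_tl s) in
  if tree_test (tor a (tor b c)) then
    Node (Node (tree_tl a) (tree_tl b))
      (Node (tmaj (tree_hd a) (tree_hd b) c)
         (Node (txor (txor (tree_hd a) (tree_hd b)) c) r))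
  else s.

Definition add_state a b c r := Node (Node a b) (Node c r).

(** An upper bound on the steps until the fixed point; the successor leaves room for the final
    carry. *)
Definition add_left a b c : nat :=
  if tree_test a || tree_test b || tree_test c
  then (maxn (spine a) (spine b)).+1 else 0.

(** Two potentials built from [add_left] bound the result; the factor 4 is one cell plus a digit of
    size at most 3. The last equation is the invariant of digitwise addition: finished digits plus
    the shifted rest keep their sum. *)
Lemma add_stepP a b c r (s := add_state a b c r) :
  exists a' b' c' r', [/\ add_step s = add_state a' b' c' r',
    [/\ tree_size a' <= tree_size a, tree_size b' <= tree_size b &
     tree_size c' <= maxn 3 (tree_size c)],
    add_left a' b' c' <= (add_left a b c).-1,
    spine r' + add_left a' b' c' <= spine r + add_left a b c &
    [/\ tree_size r' + 4 * add_left a' b' c'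
         <= tree_size r + 4 * add_left a b c &
    bval (tcatrev r' Leaf) + 2 ^ spine r' * (bval a' + bval b' + tree_test c') =
    bval (tcatrev r Leaf) + 2 ^ spine r * (bval a + bval b + tree_test c)]].
Proof.
pose x := tree_hd a; pose y := tree_hd b.
have va : bval a = tree_test x + 2 * bval (tree_tl a) by rewrite /x; case: (a).
have vb : bval b = tree_test y + 2 * bval (tree_tl b) by rewrite /y; case: (b).
have sa := tree_size_tl a; have sb := tree_size_tl b.
have la : spine (tree_tl a) = (spine a).-1 by case: (a).
have lb : spine (tree_tl b) = (spine b).-1 by case: (b).
have a0 : tree_test a = (0 < spine a) by case: (a).
have b0 : tree_test b = (0 < spine b) by case: (b).
have ta0 : tree_test (tree_tl a) = (1 < spine a) by case: (a) => // ? [].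
have tb0 : tree_test (tree_tl b) = (1 < spine b) by case: (b) => // ? [].
rewrite /s /add_step /= -/x -/y.
have -> : tree_test (tor a (tor b c)) =
    [|| tree_test a, tree_test b | tree_test c].
  by rewrite /tor; case: (tree_test a) => //; case: (tree_test b).
case h: [|| _, _ | _]; last first.
  exists a, b, c, r; rewrite /add_left -orbA h; split=> //; split=> //.
  by rewrite leq_max leqnn orbT.
have left_eq : add_left a b c = (maxn (spine a) (spine b)).+1.
  by rewrite /add_left -orbA h.
have le_left : add_left (tree_tl a) (tree_tl b) (tmaj x y c) <=
  maxn (spine a) (spine b).
  (* With both summands exhausted, the majority of two zeros and the carry is zero, so nothing
     remains to be done. *)
  case: (posnP (maxn (spine a) (spine b))) => [hm|hm].
    have [ha hb] : a = Leaf /\ b = Leaf.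
      by split; [move: hm; case: (a) | move: hm; case: (b)] => //= *; lia.
    by rewrite /x /y ha hb.
  by rewrite /add_left la lb; case: ifP => _; lia.
exists (tree_tl a), (tree_tl b), (tmaj x y c), (Node (txor (txor x y) c) r).
split=> //.
- by split=> //; rewrite /tmaj; repeat case: ifP => _ /=; lia.
- by rewrite left_eq.
- by rewrite left_eq /=; lia.
split.
  rewrite left_eq /=.
  have : tree_size (txor (txor x y) c) <= 3.
    by rewrite /txor; repeat case: ifP => _ /=.
  by lia.
rewrite /= bval_tcatrev /= va vb expnS /tmaj /txor.
by case: (tree_test x); case: (tree_test y); case: (tree_test c) => /=; lia.
Qed.

Lemma iter_add i a b c r (s := add_state a b c r) :
  exists a' b' c' r', [/\ iter i add_step s = add_state a' b' c' r',
    [/\ tree_size a' <= tree_size a, tree_size b' <= tree_size b &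
     tree_size c' <= maxn 3 (tree_size c)],
    add_left a' b' c' <= add_left a b c - i,
    spine r' <= spine r + add_left a b c &
    [/\ tree_size r' <= tree_size r + 4 * add_left a b c &
    bval (tcatrev r' Leaf) + 2 ^ spine r' * (bval a' + bval b' + tree_test c') =
    bval (tcatrev r Leaf) + 2 ^ spine r * (bval a + bval b + tree_test c)]].
Proof.
rewrite /s {s}; elim: i a b c r => [|i ih] a b c r.
  by exists a, b, c, r; split=> //; try split=> //; lia.
have [a1 [b1 [c1 [r1 [e1 [sa1 sb1 sc1] l1 sp1 [sz1 v1]]]]]] :=
  add_stepP a b c r.
have [a2 [b2 [c2 [r2 [e2 [sa2 sb2 sc2] l2 sp2 [sz2 v2]]]]]] := ih a1 b1 c1 r1.
exists a2, b2, c2, r2; rewrite iterSr e1 e2; split=> //; first 1 last.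
- by lia.
- by lia.
- by split; [lia | rewrite v2].
- by split; lia.
Qed.

(** The counter has spine [spine a + spine b + 1], enough for all steps by [add_left_le], and
    surplus steps change nothing. The outer [tcatrev] puts the least significant digit first
    again. *)
Definition tadd (a b : tree) : tree :=
  tcatrev (tree_tl (tree_tl (iter (spine (tcatrev a (Node Leaf b))) add_step
    (add_state a b Leaf Leaf)))) Leaf.

Lemma add_left_le a b : add_left a b Leaf <= (maxn (spine a) (spine b)).+1.
Proof. by rewrite /add_left; case: ifP. Qed.

Lemma ptime_tadd g h : ptime g -> ptime h ->
  ptime (fun d => tadd (g d) (h d)).
Proof.
apply: ptime_app2; apply: ptime_catrev; last by ptime.
do 2!apply: ptime_tl.
apply: (ptime_iter (B := fun d => 20 + 10 * tree_size d)).
- by apply: ptime_catrev; ptime.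
- by rewrite /add_state; ptime.
- by rewrite /add_step /tor /tmaj /txor; ptime.
- poly_bound.
move=> d i; have [a [b [c [r [-> [ha hb hc] _ _ [hr _]]]]]] :=
  iter_add i (tree_hd d) (tree_tl d) Leaf Leaf.
move: hc hr => /= hc hr.
have := add_left_le (tree_hd d) (tree_tl d).
have := spine_le_size (tree_hd d); have := spine_le_size (tree_tl d).
have := tree_size_hd d; have := tree_size_tl d; lia.
Qed.

(** The bounds involve only lengths, not sizes, since all digits of the sum are rebuilt as [Leaf] or
    [tone]. *)
Lemma taddP a b :
  [/\ bval (tadd a b) = bval a + bval b,
      spine (tadd a b) <= (maxn (spine a) (spine b)).+1 &
      tree_size (tadd a b) <= 1 + 4 * (maxn (spine a) (spine b)).+1].
Proof.
rewrite /tadd; set n := spine (tcatrev _ _).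
have hn : n = spine a + (spine b).+1 by rewrite /n spine_tcatrev.
have hl := add_left_le a b.
have [a' [b' [c' [r [-> _ l0 hs [hr hv]]]]]] := iter_add n a b Leaf Leaf.
have {}l0 : add_left a' b' c' = 0 by lia.
have [ea eb ec] : [/\ a' = Leaf, b' = Leaf & tree_test c' = false].
  move: l0; rewrite /add_left; case: ifP => // + _.
  by move: (a') (b') (c') => [|??] [|??] [|??].
move: hv hs hr; rewrite /= ea eb ec /= !addn0 !muln0 !mul1n addn0 => hv hs hr.
split=> //.
- by rewrite spine_tcatrev /= addn0; lia.
- by have := size_tcatrev r Leaf => /=; lia.
Qed.

(** Comparison from the least significant digit up: the flag is the verdict so far, overruled by any
    later differing digit and kept by equal ones. *)
Definition le_step (s : tree) : tree :=
  let a := tree_hd (tree_hd s) in let b := tree_tl (tree_hd s) in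
  let f := tree_tl s in
  Node (Node (tree_tl a) (tree_tl b))
    (if tree_test (tree_hd a) then (if tree_test (tree_hd b) then f else Leaf)
     else (if tree_test (tree_hd b) then tone else f)).

Definition tle (a b : tree) : tree :=
  tree_tl (iter (spine (tcatrev a b)) le_step (Node (Node a b) tone)).

Lemma iter_le n a b f : spine a <= n -> spine b <= n ->
  tree_test (tree_tl (iter n le_step (Node (Node a b) f))) =
  (bval a < bval b) || (bval a == bval b) && tree_test f.
Proof.
elim: n a b f => [|n ih] a b f.
  by case: a b => [|? ?] [|? ?].
have spine_tl d : spine d <= n.+1 -> spine (tree_tl d) <= n by case: d.
move=> /spine_tl ha /spine_tl hb; rewrite iterSr [le_step _]/= ih //.
have -> : bval a = tree_test (tree_hd a) + 2 * bval (tree_tl a) by case: (a).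
have -> : bval b = tree_test (tree_hd b) + 2 * bval (tree_tl b) by case: (b).
move: (bval (tree_tl a)) (bval (tree_tl b)) => x y.
case: (tree_test (tree_hd a)); case: (tree_test (tree_hd b)) => /=;
  case: (tree_test f) => /=; lia.
Qed.

Lemma tleP a b : tree_test (tle a b) = (bval a <= bval b).
Proof.
rewrite /tle spine_tcatrev iter_le ?leq_addr ?leq_addl // andbT.
by rewrite orbC -leq_eqVlt.
Qed.

Lemma ptime_tle g h : ptime g -> ptime h ->
  ptime (fun d => tle (g d) (h d)).
Proof.
apply: ptime_app2; apply: ptime_tl.
apply: (ptime_iter (B := fun d => 5 + 2 * tree_size d)).
- by apply: ptime_catrev; ptime.
- by ptime.
- by rewrite /le_step; ptime.
- poly_bound.
move=> d i.
suff [a [b [f [-> ha hb hf]]]] : exists a b f,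
    [/\ iter i le_step (Node (Node (tree_hd d) (tree_tl d)) tone) =
        Node (Node a b) f, tree_size a <= tree_size d,
        tree_size b <= tree_size d & tree_size f <= 3].
  by rewrite /=; lia.
elim: i => [|i [a [b [f [e ha hb hf]]]]].
  exists (tree_hd d), (tree_tl d), tone; split=> //.
  - exact: tree_size_hd.
  - exact: tree_size_tl.
rewrite iterS e /le_step /=; do 3!eexists; split; first by [].
- exact: leq_trans (tree_size_tl _) ha.
- exact: leq_trans (tree_size_tl _) hb.
- by do 2!case: ifP => _.
Qed.

(** Horner's scheme on the digits of [a], most significant first: [Node Leaf] doubles the
    accumulator before [b] or nothing is added. *)
Definition mul_step (s : tree) : tree :=
  let a := tree_hd (tree_hd s) in let b := tree_tl (tree_hd s) in
  if tree_test a then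
    Node (Node (tree_tl a) b)
      (tadd (if tree_test (tree_hd a) then b else Leaf) (Node Leaf (tree_tl s)))
  else s.

Definition tmul (a b : tree) : tree :=
  let ra := tcatrev a Leaf in
  tree_tl (iter (spine ra) mul_step (Node (Node ra b) Leaf)).

(** A step lengthens the accumulator by at most two digits, one for the doubling and one for the
    carry; hence [2 * spine a] in the potential. *)
Lemma iter_mul M i a b r :
  maxn (spine b) (spine r) + 2 * spine a <= M -> tree_size r <= 1 + 4 * M ->
  exists a' r', [/\ iter i mul_step (Node (Node a b) r) = Node (Node a' b) r',
    spine a' = spine a - i, tree_size a' <= tree_size a &
    [/\ spine r' <= M, tree_size r' <= 1 + 4 * M
     & bval (tcatrev a' Leaf) * bval b + 2 ^ spine a' * bval r' =
       bval (tcatrev a Leaf) * bval b + 2 ^ spine a * bval r]].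
Proof.
elim: i a r => [|i ih] a r hM hr.
  by exists a, r; rewrite subn0; split=> //; split=> //; lia.
rewrite iterSr /mul_step /=; case: a hM hr => [|x a] /= hM hr.
  have [a' [r' [e1 e2 e3 [h1 h2 h3]]]]  := ih Leaf r hM hr.
  by exists a', r'; split.
pose r1 := tadd (if tree_test x then b else Leaf) (Node Leaf r).
have [v1 s1 z1] := taddP (if tree_test x then b else Leaf) (Node Leaf r).
rewrite -/r1 /= in v1 s1 z1 *.
have sb : spine (if tree_test x then b else Leaf) <= spine b by case: ifP.
have vb : bval (if tree_test x then b else Leaf) = tree_test x * bval b.
  by case: ifP; rewrite ?mul1n.
have [||a' [r' [e1 e2 e3 [h1 h2 h3]]]] := ih a r1; try by lia.
exists a', r'; split=> //; try by lia.
split; try by lia.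
rewrite h3 v1 vb [in RHS]bval_tcatrev /= expnS; lia.
Qed.

Lemma iter_mul0 i a b (ra := tcatrev a Leaf) :
  exists a' r',
  [/\ iter i mul_step (Node (Node ra b) Leaf) = Node (Node a' b) r',
    spine a' = spine a - i, tree_size a' <= tree_size a &
    [/\ spine r' <= spine b + 2 * spine a,
     tree_size r' <= 1 + 4 * (spine b + 2 * spine a)
     & bval (tcatrev a' Leaf) * bval b + 2 ^ spine a' * bval r' = bval a * bval b]].
Proof.
have sa : spine ra = spine a by rewrite spine_tcatrev addn0.
have [||a' [r' [h1 h2 h3 [h4 h5 h6]]]] :=
  @iter_mul (spine b + 2 * spine a) i ra b Leaf.
- by rewrite sa maxn0.
- exact: leq_addr.
have za : tree_size ra = tree_size a.
  by have := size_tcatrev a Leaf; rewrite /= -/ra; lia.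
have catrevK x y : tcatrev (tcatrev x y) Leaf = tcatrev y x.
  by elim: x y => //= x1 _ x ih y; rewrite ih.
exists a', r'; rewrite sa za in h2 h3.
by split=> //; split=> //; rewrite h6 /ra catrevK /= muln0 addn0.
Qed.

Lemma tmulP a b :
  [/\ bval (tmul a b) = bval a * bval b,
      spine (tmul a b) <= spine b + 2 * spine a &
      tree_size (tmul a b) <= 1 + 4 * (spine b + 2 * spine a)].
Proof.
rewrite /tmul spine_tcatrev addn0.
have [a' [r' [-> h2 _ [h4 h5 h6]]]] := @iter_mul0 (spine a) a b.
rewrite subnn in h2; split=> //; move: h2 h6.
by case: (a') => //= _; rewrite mul0n mul1n.
Qed.

Lemma ptime_tmul g h : ptime g -> ptime h ->
  ptime (fun d => tmul (g d) (h d)).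
Proof.
apply: ptime_app2; apply: ptime_tl.
have pr : ptime (fun d => tcatrev (tree_hd d) Leaf).
  by apply: ptime_catrev; ptime.
apply: (ptime_iter (B := fun d => 5 + 20 * tree_size d)) => //.
- by ptime.
- by rewrite /mul_step; ptime; apply: ptime_tadd; ptime.
- poly_bound.
move=> d i.
have [a' [r' [-> _ h3 [h4 h5 _]]]] := iter_mul0 i (tree_hd d) (tree_tl d).
have := spine_le_size (tree_hd d); have := spine_le_size (tree_tl d).
have := tree_size_hd d; have := tree_size_tl d => /=; lia.
Qed.

(** * Fractions *)

(** Fractions are never reduced. In each product the factor from [p] comes first, because the length
    bound in [tmulP] doubles only the first factor. *)
Definition tadd_frac (p q : tree) : tree :=
  Node (tadd (tmul (tree_tl p) (tree_hd q)) (tmul (tree_hd p) (tree_tl q)))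
       (tmul (tree_tl p) (tree_tl q)).

Definition tle_frac (p q : tree) : tree :=
  tle (tmul (tree_hd p) (tree_tl q)) (tmul (tree_hd q) (tree_tl p)).

Lemma ptime_tadd_frac g h : ptime g -> ptime h ->
  ptime (fun d => tadd_frac (g d) (h d)).
Proof.
by move=> hg hh; rewrite /tadd_frac; apply: ptime_node;
  [apply: ptime_tadd|]; apply: ptime_tmul; ptime.
Qed.

Lemma ptime_tle_frac g h : ptime g -> ptime h ->
  ptime (fun d => tle_frac (g d) (h d)).
Proof.
by move=> hg hh; apply: ptime_tle; apply: ptime_tmul; ptime.
Qed.

Definition frac_len (p : tree) : nat :=
  maxn (spine (tree_hd p)) (spine (tree_tl p)).

Lemma frac_len_le p : frac_len p <= tree_size p.
Proof.
rewrite /frac_len; have := spine_le_size (tree_hd p).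
have := spine_le_size (tree_tl p).
have := tree_size_hd p; have := tree_size_tl p; lia.
Qed.

(** The coefficient 1 of [frac_len q] is essential: with the running total as second summand,
    repeated addition makes it grow by increments and not geometrically. *)
Lemma frac_len_tadd p q :
  frac_len (tadd_frac p q) <= frac_len q + 2 * frac_len p + 1.
Proof.
rewrite /frac_len /=.
have [_ h1 _] := taddP (tmul (tree_tl p) (tree_hd q))
  (tmul (tree_hd p) (tree_tl q)).
have [_ h2 _] := tmulP (tree_tl p) (tree_hd q).
have [_ h3 _] := tmulP (tree_hd p) (tree_tl q).
have [_ h4 _] := tmulP (tree_tl p) (tree_tl q).
lia.
Qed.

Lemma size_tadd_frac p q :
  tree_size (tadd_frac p q) <= 15 + 20 * (frac_len q + 2 * frac_len p).
Proof.
rewrite /frac_len /=.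
have [_ _ h1] := taddP (tmul (tree_tl p) (tree_hd q))
  (tmul (tree_hd p) (tree_tl q)).
have [_ h2 _] := tmulP (tree_tl p) (tree_hd q).
have [_ h3 _] := tmulP (tree_hd p) (tree_tl q).
have [_ _ h4] := tmulP (tree_tl p) (tree_tl q).
lia.
Qed.

Section Frac.
Local Open Scope ring_scope.

Definition is_frac (p : tree) (q : rat) : Prop :=
  (0 < bval (tree_tl p))%N /\
  q = (bval (tree_hd p))%:R / (bval (tree_tl p))%:R.

Lemma is_frac_add p q x y :
  is_frac p x -> is_frac q y -> is_frac (tadd_frac p q) (x + y).
Proof.
move=> [p0 ->] [q0 ->]; rewrite /is_frac /=.
have [-> _ _] := taddP (tmul (tree_tl p) (tree_hd q))
  (tmul (tree_hd p) (tree_tl q)).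
have [-> _ _] := tmulP (tree_tl p) (tree_hd q).
have [-> _ _] := tmulP (tree_hd p) (tree_tl q).
have [-> _ _] := tmulP (tree_tl p) (tree_tl q).
rewrite muln_gt0 p0 q0 natrD !natrM; split=> //.
by rewrite addf_div ?pnatr_eq0 -?lt0n // [X in _ = (X + _) / _]mulrC addrC
  [_ + _ * _]addrC.
Qed.

Lemma is_frac_le p q x y : is_frac p x -> is_frac q y ->
  tree_test (tle_frac p q) = (x <= y).
Proof.
move=> [p0 ->] [q0 ->]; rewrite tleP.
have [-> _ _] := tmulP (tree_hd p) (tree_tl q).
have [-> _ _] := tmulP (tree_hd q) (tree_tl p).
rewrite ler_pdivrMr ?ltr0n // mulrAC ler_pdivlMr ?ltr0n //.
by rewrite -!natrM ler_nat.
Qed.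

Lemma is_frac_enc_rat q : 0 <= q -> is_frac (enc_rat q) q.
Proof.
move=> q0; rewrite /is_frac /= !bval_enc_binary absz_gt0 denq_neq0; split=> //.
rewrite -[LHS]divq_num_den !natr_absz.
by rewrite ger0_norm ?numq_ge0 // ger0_norm ?ltW ?denq_gt0.
Qed.

Lemma is_frac0 : is_frac (Node Leaf (Node tone Leaf)) 0.
Proof. by split. Qed.

End Frac.

(** * Cutting a Hamiltonian cycle into paths *)

Definition tweight (g u v : tree) : tree :=
  tree_hd (tdrop v (tree_hd (tdrop u g))).

(** Since [k] is a constant, loops of length depending on [k] are unrolled outside the programming
    language; the same holds for [ttake] and [tbest]. *)
Fixpoint tpath_weight (j : nat) (g l : tree) : tree :=
  if j is j'.+1 then
    tadd_frac (tweight g (tree_hd l) (tree_hd (tree_tl l)))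
      (tpath_weight j' g (tree_tl l))
  else Node Leaf (Node tone Leaf).

Fixpoint ttake (k : nat) (l : tree) : tree :=
  if k is k'.+1 then Node (tree_hd l) (ttake k' (tree_tl l)) else Leaf.

(** The state holds the graph, the vertices still to be cut, the paths cut off so far, and their
    total weight as a fraction. *)
Definition cut_step (k : nat) (s : tree) : tree :=
  let g := tree_hd s in let l := tree_hd (tree_tl s) in
  let out := tree_hd (tree_tl (tree_tl s)) in
  let w := tree_tl (tree_tl (tree_tl s)) in
  if tree_test l then
    Node g (Node (iter k tree_tl l)
      (Node (Node (ttake k l) out) (tadd_frac (tpath_weight k.-1 g l) w)))
  else s.

Definition tcut (k : nat) (g l : tree) : tree :=
  tree_tl (tree_tl (iter (spine l) (cut_step k)
    (Node g (Node l (Node Leaf (Node Leaf (Node tone Leaf))))))).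

Definition trot (l : tree) : tree :=
  tcatrev (tcatrev (tree_tl l) Leaf) (Node (tree_hd l) Leaf).

(** A search over the offsets [0] to [j]; each candidate carries its path weight in its tail for the
    comparison. *)
Fixpoint tbest (j k : nat) (g l : tree) : tree :=
  if j is j'.+1 then
    if tree_test (tle_frac (tree_tl (tbest j' k g (trot l)))
                           (tree_tl (tcut k g l)))
    then tcut k g l else tbest j' k g (trot l)
  else tcut k g l.

Lemma ptime_tpath_weight j g l : ptime g -> ptime l ->
  ptime (fun d => tpath_weight j (g d) (l d)).
Proof.
move=> hg; elim: j l => [|j ih] l hl /=; first by ptime.
apply: ptime_tadd_frac; last by apply: ih; ptime.
by apply: ptime_hd; apply: ptime_tdrop; ptime; apply: ptime_tdrop; ptime.
Qed.

Lemma ptime_ttake k l : ptime l -> ptime (fun d => ttake k (l d)).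
Proof.
elim: k l => [|k ih] l hl /=; first by ptime.
by apply: ptime_node; [ptime | apply: ih; ptime].
Qed.

Lemma ptime_iter_tl k l : ptime l -> ptime (fun d => iter k tree_tl (l d)).
Proof. by move=> hl; elim: k => //= k ih; ptime. Qed.

Lemma size_ttake k l : tree_size (ttake k l) <= tree_size l + 2 * k.
Proof.
elim: k l => [|k ih] l /=; first by rewrite addn0 tree_size_gt0.
by have := ih (tree_tl l); case: l => [|a b] /=; lia.
Qed.

Lemma size_iter_tl k l : tree_size (iter k tree_tl l) <= tree_size l.
Proof. by elim: k => //= k; apply: leq_trans (tree_size_tl _). Qed.

Lemma spine_iter_tl k l : spine (iter k tree_tl l) = spine l - k.
Proof.
elim: k => [|k ih] /=; first by rewrite subn0.
by rewrite subnS -ih; case: (iter _ _ _).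
Qed.

Lemma ptime_tcut k g l : 0 < k -> ptime g -> ptime l ->
  ptime (fun d => tcut k (g d) (l d)).
Proof.
move=> k0; apply: ptime_app2; do 2!apply: ptime_tl.
have [[b hb] _] := ptime_tpath_weight k.-1 (ptime_hd ptime_id)
  (ptime_tl ptime_id).
(* [Q d] bounds the length of one path weight, so a step lengthens the total by at most
   [2 * Q d + 1], and it enlarges the list of paths by at most [C d]. Each effective step shortens
   the vertex list, so both increments are charged to its spine. *)
pose Q d := (2 * tree_size d + 2) ^ b.
pose C d := tree_size d + 2 * k + 2.
apply: (ptime_iter (B := fun d => 30 + 2 * tree_size d + tree_size d * C d +
  20 * (1 + tree_size d * (2 * Q d + 1) + 2 * Q d))).
- by ptime.
- by ptime.
- have pw : ptime (fun s => tadd_frac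
      (tpath_weight k.-1 (tree_hd s) (tree_hd (tree_tl s)))
      (tree_tl (tree_tl (tree_tl s)))).
    by apply: ptime_tadd_frac; [apply: ptime_tpath_weight |]; ptime.
  rewrite /cut_step; ptime.
  + by apply: ptime_iter_tl; ptime.
  + by apply: ptime_ttake; ptime.
- have hQ : poly_bounded Q by apply: poly_bounded_exp; poly_bound.
  by rewrite /C; poly_bound.
move=> d i; set g0 := tree_hd d; set l0 := tree_tl d.
have hg0 : tree_size g0 <= tree_size d by apply: tree_size_hd.
have hl0 : tree_size l0 <= tree_size d by apply: tree_size_tl.
have sl0 : spine l0 <= tree_size d by apply: leq_trans (spine_le_size _) hl0.
suff [l1 [r [w [-> hl [hr hw] hz]]]] : exists l1 r w,
    [/\ iter i (cut_step k)
          (Node g0 (Node l0 (Node Leaf (Node Leaf (Node tone Leaf))))) =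
        Node g0 (Node l1 (Node r w)),
        tree_size l1 <= tree_size d,
        tree_size r + spine l1 * C d <= 1 + spine l0 * C d /\
        frac_len w + spine l1 * (2 * Q d + 1) <=
          1 + spine l0 * (2 * Q d + 1)
      & tree_size w <= 15 + 20 * (1 + spine l0 * (2 * Q d + 1) + 2 * Q d)].
  have le1 : spine l0 * C d <= tree_size d * C d by rewrite leq_mul2r sl0 orbT.
  have le2 : spine l0 * (2 * Q d + 1) <= tree_size d * (2 * Q d + 1).
    by rewrite leq_mul2r sl0 orbT.
  by rewrite /=; lia.
elim: i => [|i [l1 [r [w [e hl [hr hw] hz]]]]].
  by exists l0, Leaf, (Node Leaf (Node tone Leaf)); split=> //=; lia.
have q1 : frac_len (tpath_weight k.-1 g0 l1) <= Q d.
  apply: leq_trans (frac_len_le _) _; apply: leq_trans (hb (Node g0 l1)) _.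
  by rewrite /Q; case: (b) => // b'; rewrite leq_exp2r //=; lia.
rewrite iterS e /cut_step /=; case: ifP => [l1n|_]; last by exists l1, r, w.
do 3!eexists; split; first by reflexivity.
- exact: leq_trans (size_iter_tl _ _) hl.
- have sl1 : (spine (iter k tree_tl l1)).+1 <= spine l1.
    by rewrite spine_iter_tl; case: (l1) l1n => //= *; lia.
  split.
    have := size_ttake k l1 => hk.
    have : (spine (iter k tree_tl l1)).+1 * C d <= spine l1 * C d.
      by rewrite leq_mul2r sl1 orbT.
    have : tree_size (ttake k l1) + 2 <= C d by rewrite /C; lia.
    by rewrite mulSn /=; lia.
  have := frac_len_tadd (tpath_weight k.-1 g0 l1) w.
  have : (spine (iter k tree_tl l1)).+1 * (2 * Q d + 1) <=
    spine l1 * (2 * Q d + 1) by rewrite leq_mul2r sl1 orbT.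
  by rewrite mulSn; lia.
- by apply: leq_trans (size_tadd_frac _ _) _; lia.
Qed.

Lemma ptime_tbest j k g l : 0 < k -> ptime g -> ptime l ->
  ptime (fun d => tbest j k (g d) (l d)).
Proof.
move=> k0 hg; elim: j l => [|j ih] l hl /=; first exact: ptime_tcut.
have hr : ptime (fun d => trot (l d)).
  by apply: ptime_catrev; [apply: ptime_catrev|]; ptime.
have hb := ih _ hr; have hc := ptime_tcut k0 hg hl.
by apply: ptime_if => //; apply: ptime_tle_frac; apply: ptime_tl.
Qed.

(** * Correctness of the cutting functions on encodings *)

Lemma tdrop_enc (T : Type) (enc : T -> tree) i s :
  tdrop (enc_unary i) (enc_seq enc s) = enc_seq enc (drop i s).
Proof.
rewrite /tdrop; have -> : spine (enc_unary i) = i by elim: i => //= i ->.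
elim: i s => [|i ih] s; first by rewrite drop0.
rewrite iterSr; case: s => [|x s]; last exact: ih.
by rewrite [tree_tl _]/= (ih [::]); case: (i).
Qed.

Lemma hd_tdrop_enum n (enc : 'I_n -> tree) (i : 'I_n) :
  tree_hd (tdrop (enc_unary i) (enc_seq enc (enum 'I_n))) = enc i.
Proof.
by rewrite tdrop_enc (drop_nth i) ?size_enum_ord //= nth_ord_enum.
Qed.

Lemma tweightE (G : metric_graph) (i j : 'I_(nverts G)) :
  tweight (enc_graph G) (enc_unary i) (enc_unary j) = enc_rat (weight i j).
Proof. by rewrite /tweight /enc_graph !hd_tdrop_enum. Qed.

Lemma ttake_enc (T : Type) (enc : T -> tree) s1 s2 :
  ttake (size s1) (enc_seq enc (s1 ++ s2)) = enc_seq enc s1.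
Proof. by elim: s1 => //= x s1 ->. Qed.

Lemma iter_tl_enc (T : Type) (enc : T -> tree) s1 s2 :
  iter (size s1) tree_tl (enc_seq enc (s1 ++ s2)) = enc_seq enc s2.
Proof. by elim: s1 => //= x s1 ih; rewrite -iterS iterSr. Qed.

Lemma trot_enc (T : Type) (enc : T -> tree) x s :
  trot (enc_seq enc (x :: s)) = enc_seq enc (rot 1 (x :: s)).
Proof.
rewrite /trot /= -[Leaf]/(enc_seq enc [::]) tcatrev_enc.
rewrite -[Node _ _]/(enc_seq enc [:: x]) tcatrev_enc rot1_cons.
by rewrite !catrevE cats0 revK cats1.
Qed.

Local Open Scope ring_scope.

Definition cut (T : Type) k m (s : seq T) := reshape (nseq m k) s.

Lemma sumn_nseqE m k : sumn (nseq m k) = (m * k)%N.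
Proof. by rewrite sumn_nseq mulnC. Qed.

Lemma flatten_cut (T : Type) k m (s : seq T) :
  size s = (m * k)%N -> flatten (cut k m s) = s.
Proof. by move=> hs; apply: reshapeKr; rewrite sumn_nseqE hs. Qed.

Lemma all_size_cut (T : Type) k m (s : seq T) : size s = (m * k)%N ->
  all (fun c : seq T => size c == k) (cut k m s).
Proof.
move=> hs; have := @reshapeKl _ (nseq m k) s.
rewrite sumn_nseqE hs leqnn => /(_ isT) sh.
have : all (pred1 k) (shape (cut k m s)) by rewrite sh all_pred1_nseq.
by rewrite /shape all_map; apply: sub_all.
Qed.

Section PathWeight.
Variable G : metric_graph.
Local Notation V := 'I_(nverts G).
Implicit Types (x y : V) (c s : seq V) (P : seq (seq V)).

Fixpoint path_weight x s : rat :=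
  if s is y :: s' then weight x y + path_weight y s' else 0.

Definition seq_weight c : rat := if c is x :: s then path_weight x s else 0.

Definition paths_weight P : rat := \sum_(c <- P) seq_weight c.

Lemma tpath_weightP c s j : size c = j.+1 ->
  is_frac (tpath_weight j (enc_graph G) (enc_cycle (c ++ s))) (seq_weight c).
Proof.
case: c => // x c [<-] {j}; elim: c x => [|y c ih] x /=; first exact: is_frac0.
apply: is_frac_add; last exact: ih.
by rewrite tweightE; apply/is_frac_enc_rat/weight_ge0.
Qed.

Lemma iter_cut k i P Q w q : (0 < k)%N -> all (fun c => size c == k) P ->
  (size P <= i)%N -> is_frac w q ->
  exists2 f, tree_tl (tree_tl (iter i (cut_step k)
    (Node (enc_graph G) (Node (enc_cycle (flatten P))
       (Node (enc_packing Q) w))))) = Node (enc_packing (catrev P Q)) f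
  & is_frac f (paths_weight P + q).
Proof.
move=> k0; rewrite /paths_weight; elim: P i Q w q => [|c P ih] i Q w q.
  move=> _ _ hw; exists w; last by rewrite big_nil add0r.
  (* Without remaining vertices [cut_step] is the identity, so surplus rounds are harmless. *)
  by rewrite iter_fix.
move=> /= /andP[/eqP sc hP]; case: i => // i hi hw.
have c0 : tree_test (enc_cycle (c ++ flatten P)).
  by case: (c) sc k0 => //= <-.
have e1 : iter k tree_tl (enc_cycle (c ++ flatten P)) = enc_cycle (flatten P).
  by rewrite -sc; apply: iter_tl_enc.
have e2 : ttake k (enc_cycle (c ++ flatten P)) = enc_cycle c.
  by rewrite -sc; apply: ttake_enc.
rewrite iterSr {2}/cut_step /= c0 e1 e2.
rewrite -[Node (enc_cycle _) (enc_packing Q)]/(enc_packing (c :: Q)).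
have hc : is_frac (tpath_weight k.-1 (enc_graph G) (enc_cycle (c ++ flatten P)))
    (seq_weight c) by apply: tpath_weightP; rewrite sc prednK.
have [f -> hf] := ih i (c :: Q) _ _ hP hi (is_frac_add hc hw).
by exists f => //; rewrite big_cons [seq_weight c + _]addrC -addrA.
Qed.

Lemma tcutP k P : (0 < k)%N -> all (fun c => size c == k) P ->
  exists2 f, tcut k (enc_graph G) (enc_cycle (flatten P)) =
    Node (enc_packing (rev P)) f & is_frac f (paths_weight P).
Proof.
move=> k0 hP; have spine_enc s : spine (enc_cycle s) = size s.
  by elim: s => //= x s ->.
have le_size : (size P <= size (flatten P))%N.
  elim: P hP => //= c P ih /andP[/eqP sc /ih hP]; rewrite size_cat sc; lia.
have [|f e hf] := @iter_cut k (size (flatten P)) P [::] _ _ k0 hP _ is_frac0.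
  by [].
by exists f; rewrite ?addr0 // in hf *; rewrite /tcut spine_enc.
Qed.

Lemma tbestP j k m s : (0 < k)%N -> size s = (m * k)%N -> (j < size s)%N ->
  exists i f, [/\ (i <= j)%N,
    tbest j k (enc_graph G) (enc_cycle s) =
      Node (enc_packing (rev (cut k m (rot i s)))) f,
    is_frac f (paths_weight (cut k m (rot i s)))
  & forall i', (i' <= j)%N -> paths_weight (cut k m (rot i' s)) <=
                      paths_weight (cut k m (rot i s))].
Proof.
move=> k0; elim: j s => [|j ih] s hs lt_js.
  have [f e hf] := tcutP k0 (all_size_cut hs).
  rewrite flatten_cut // in e; exists 0%N, f; rewrite rot0; split=> //.
  by move=> i'; rewrite leqn0 => /eqP->; rewrite rot0.
have rotS i : (i <= j)%N -> rot i (rot 1 s) = rot i.+1 s.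
  by move=> le_ij; rewrite -rotD ?addn1 //; lia.
have [i [f [le_ij e hf mx]]] := ih (rot 1 s) (etrans (size_rot _ _) hs)
  (leq_trans (ltnW lt_js) (eq_leq (esym (size_rot 1 s)))).
have [f0 e0 hf0] := tcutP k0 (all_size_cut hs); rewrite flatten_cut // in e0.
have er : trot (enc_cycle s) = enc_cycle (rot 1 s).
  by case: (s) lt_js => // x s' _; apply: trot_enc.
rewrite rotS // in e hf mx.
rewrite /= er e e0 /= (is_frac_le hf hf0); case: leP => [le_b|/ltW le_b].
  exists 0%N, f0; rewrite rot0; split=> // -[|i'] hi'; first by rewrite rot0.
  by rewrite -rotS //; apply: le_trans (mx _ _) le_b.
exists i.+1, f; split=> // -[|i'] hi'; first by rewrite rot0.
by rewrite -rotS //; apply: mx.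
Qed.

End PathWeight.

(** * Cycle and path weights as sums over positions *)

Section CycleWeight.
Variable G : metric_graph.
Local Notation V := 'I_(nverts G).
Implicit Types (x y : V) (c s : seq V) (P : seq (seq V)).

Lemma cycle_weight_nth x0 c : uniq c ->
  cycle_weight c = \sum_(0 <= t < size c)
    weight (nth x0 c (t %% size c)) (nth x0 c (t.+1 %% size c)).
Proof.
move=> uc; rewrite /cycle_weight (big_nth x0); apply: eq_big_nat => t /= ltc.
rewrite modn_small // next_nth mem_nth // index_uniq //; congr weight.
(* At the last position the successor's index runs past the tail, and the default of [nth] is the
   head [y], in agreement with the index modulo [size c]. *)
case: c uc ltc => // y c _ /=; rewrite ltnS leq_eqVlt => /orP[/eqP->|ltc].
  by rewrite modnn nth_default.
by rewrite modn_small ?ltnS //=; apply: set_nth_default.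
Qed.

Lemma path_weight_nth x0 x s : path_weight x s =
  \sum_(0 <= t < size s) weight (nth x0 (x :: s) t) (nth x0 (x :: s) t.+1).
Proof.
elim: s x => [|y s ih] x; first by rewrite big_nil.
by rewrite [LHS]/= ih [size _]/= big_nat_recl.
Qed.

Lemma cycle_weight_cons x s : uniq (x :: s) ->
  cycle_weight (x :: s) = path_weight x s + weight (last x s) x.
Proof.
move=> us; rewrite (cycle_weight_nth x) // [size _]/= big_nat_recr //=.
rewrite modnn modn_small // -[X in weight X _]/(nth x (x :: s) (size s)).
rewrite -[size s]/(size (x :: s)).-1 nth_last (path_weight_nth x).
congr (_ + _).
apply: eq_big_nat => t /= lts.
by rewrite !modn_small // ltnS ltnW.
Qed.

Lemma seq_weight_le_cycle c : uniq c -> seq_weight c <= cycle_weight c.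
Proof.
case: c => [|x s] us; first by rewrite /cycle_weight big_nil.
by rewrite cycle_weight_cons // lerDl weight_ge0.
Qed.

Lemma paths_weight_nth x0 k m s : (0 < k)%N -> size s = (m * k)%N ->
  paths_weight (cut k m s) = \sum_(0 <= j < m) \sum_(0 <= r < k.-1)
    weight (nth x0 s (j * k + r)) (nth x0 s (j * k + r).+1).
Proof.
move=> k0; elim: m s => [|m ih] s hs.
  by rewrite /paths_weight /cut /= !big_nil.
have st : size (take k s) = k by rewrite size_takel // hs mulSn leq_addr.
rewrite /paths_weight [cut _ _ _]/= big_cons -/(cut k m _) -/(paths_weight _).
rewrite ih; last first.
  by rewrite size_drop hs mulSn addKn.
rewrite [RHS]big_nat_recl //; congr (_ + _).
  case e: (take k s) st => [|x c] st; first by rewrite -st in k0.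
  rewrite /= (path_weight_nth x0) -st /=; apply: eq_big_nat => r /= ltr.
  rewrite -[x :: c]e nth_take; last by rewrite -st /= ltnS ltnW.
  by rewrite -[nth x0 c r]/(nth x0 (x :: c) r.+1) -e nth_take // -st.
apply: eq_bigr => j _; apply: eq_bigr => r _.
by rewrite !nth_drop mulSn -addnA -!addnS.
Qed.

Lemma nth_rot (T : Type) (x0 : T) (s : seq T) i t :
  (i < size s)%N -> (t < size s)%N ->
  nth x0 (rot i s) t = nth x0 s ((i + t) %% size s).
Proof.
move=> lti ltt; rewrite /rot nth_cat size_drop nth_drop.
case: ltnP => h; first by rewrite modn_small //; lia.
rewrite nth_take; last by lia.
congr nth; have -> : (i + t = (t - (size s - i)) + size s)%N by lia.
by rewrite modnDr modn_small //; lia.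
Qed.

Lemma sum_nat_mul (f : nat -> rat) m k :
  \sum_(0 <= j < m) \sum_(0 <= i < k) f (j * k + i)%N =
  \sum_(0 <= t < m * k) f t.
Proof.
elim: m => [|m ih]; first by rewrite !big_nil.
rewrite big_nat_recr //= ih [in RHS](big_cat_nat _ (n := m * k)) //; last first.
  by rewrite mulSn leq_addl.
congr (_ + _); rewrite -{2}[(m * k)%N]add0n mulSn [(k + _)%N]addnC.
rewrite big_addn addKn; by apply: eq_bigr => i _; rewrite addnC.
Qed.

(** Moving the window by one trades [f r] for the equal [f (r + n)]. *)
Lemma sum_shift_periodic (f : nat -> rat) n r :
  (forall t, f (t + n)%N = f t) ->
  \sum_(0 <= t < n) f (r + t)%N = \sum_(0 <= t < n) f t.
Proof.
move=> per; elim: r => [|r <-]; first by [].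
have := @big_nat_recl _ 0 +%R n 0 (fun t => f (r + t)%N) (leq0n _).
rewrite big_nat_recr //= addn0 per addrC => /addrI ->.
by apply: eq_bigr => t _; rewrite addSnnS.
Qed.

(* Each edge of the cycle is cut by exactly one of the k rotations. *)
Lemma sum_paths_weight_rot k m c : uniq c -> (0 < m)%N -> (0 < k)%N ->
  size c = (m * k)%N ->
  \sum_(0 <= i < k) paths_weight (cut k m (rot i c)) =
  k.-1%:R * cycle_weight c.
Proof.
move=> uc m0 k0 hc; have [x0 _] : exists x0, x0 \in c.
  by case: (c) hc m0 k0 => [|x c'] /=; [lia | exists x; rewrite inE eqxx].
pose e t := weight (nth x0 c (t %% size c)) (nth x0 c (t.+1 %% size c)).
have per t : e (t + size c)%N = e t.
  by rewrite /e -addSn !modnDr.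
have rotE i : (i < k)%N -> paths_weight (cut k m (rot i c)) =
    \sum_(0 <= r < k.-1) \sum_(0 <= j < m) e (r + (j * k + i))%N.
  move=> ltik; rewrite (paths_weight_nth x0) ?size_rot // exchange_big_nat /=.
  apply: eq_big_nat => r /= ltr; apply: eq_big_nat => j /= ltj.
  have h : (j * k + k <= m * k)%N by rewrite addnC -mulSn leq_mul2r ltj orbT.
  rewrite !nth_rot; try by rewrite hc; lia.
  by rewrite /e; congr (weight (nth _ _ (_ %% _)) (nth _ _ (_ %% _))); lia.
rewrite (eq_big_nat _ _ (F2 := fun i => \sum_(0 <= r < k.-1)
  \sum_(0 <= j < m) e (r + (j * k + i))%N)); last by move=> i /=; apply: rotE.
(* For fixed [r] the index [j * k + i] meets every position once, so each of the [k.-1] values of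
   [r] contributes the whole cycle weight, shifted by [r]. *)
rewrite exchange_big_nat /=.
under eq_bigr => r _ do rewrite exchange_big_nat /=
  (sum_nat_mul (fun t => e (r + t)%N)) -hc sum_shift_periodic //.
by rewrite -(cycle_weight_nth x0) // sumr_const_nat subn0 mulr_natl.
Qed.

(** * Patching the cycles of a packing together *)

Definition gap c : rat := if c is x :: s then weight (last x s) x else 0.

(** Some edge weighs at most the mean; rotating the cycle to start just behind it makes it the
    closing edge, which [gap] measures. *)
Lemma lightest_edge c : uniq c -> (0 < size c)%N ->
  exists q, [/\ perm_eq q c, cycle_weight c = seq_weight q + gap q
    & (size c)%:R * gap q <= cycle_weight c].
Proof.
move=> uc c0.
have [x xc hx] : exists2 x, x \in c &
    (size c)%:R * weight x (next c x) <= cycle_weight c.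
  apply/hasP; apply/negPn/negP => /hasPn hn.
  have : \sum_(x <- c) cycle_weight c <
         \sum_(x <- c) (size c)%:R * weight x (next c x).
    rewrite big_seq [X in _ < X]big_seq; apply: ltr_sum => [|x xc].
      by apply/hasP; case: (c) c0 => // x s _; exists x; rewrite mem_head.
    by rewrite ltNge; apply: hn.
  by rewrite -mulr_sumr big_const_seq count_predT iter_addr_0 mulr_natl ltxx.
have yc : next c x \in c by rewrite mem_next.
have [i s hi] := rot_to yc; set y := next c x in yc hi hx.
have uq : uniq (y :: s) by rewrite -hi rot_uniq.
have xlast : x = last y s.
  (* [x] is the predecessor of the head [y]. As [y] does not occur in [s], its index there is
     [size s], which points to the last entry of [y :: s]. *)
  have := prev_next uq x; rewrite -hi next_rot // -/y hi prev_nth inE eqxx /=.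
  have /andP[ys _] := uq; rewrite (memNindex ys) => <-.
  by rewrite -[size s]/(size (y :: s)).-1 nth_last.
have pq : perm_eq (y :: s) c by rewrite -hi perm_rot.
exists (y :: s); split=> //=; last by rewrite -xlast.
rewrite -cycle_weight_cons // /cycle_weight (perm_big _ pq).
by apply: eq_bigr => z _; rewrite -hi next_rot.
Qed.

Lemma path_weight_cat x s1 s2 :
  path_weight x (s1 ++ s2) = path_weight x s1 + path_weight (last x s1) s2.
Proof. by elim: s1 x => [|y s ih] x /=; rewrite ?add0r // ih addrA. Qed.

Lemma reverse_path x s : exists s' , [/\ perm_eq (last x s :: s') (x :: s),
  last (last x s) s' = x & path_weight (last x s) s' = path_weight x s].
Proof.
elim: s x => [|y s ih] x; first by exists [::].
have [s' [p l w]] := ih y; exists (rcons s' x); split=> /=.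
- rewrite -rcons_cons (perm_trans (_ : perm_eq _ (x :: last y s :: s'))) //.
    by rewrite perm_rcons.
  by rewrite perm_cons.
- by rewrite last_rcons.
- by rewrite -cats1 path_weight_cat w l /= addr0 addrC weight_sym.
Qed.

Lemma gap_le x y (t : V) : weight y x <= weight t x + weight t y.
Proof. by rewrite addrC (weight_sym t y); apply: weight_triangle. Qed.

(* Of the two ways to traverse a path, one starts far from [t]: the two ends
   have total distance at least [gap] from [t]. The last path is connected on
   both sides, which pays for the additional [mu]. *)
Lemma connect_paths (mu : rat) Q (t s0 : V) : Q <> [::] ->
  all (fun q => 0 < size q)%N Q -> all (fun q => mu <= gap q) Q ->
  exists2 H, perm_eq H (flatten Q) &
    \sum_(q <- Q) (seq_weight q + gap q / 2) + mu / 2 <=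
    path_weight t (rcons H s0).
Proof.
elim: Q t => // -[//|a s] Q ih t _ /= hQ /andP[hmu hQmu].
have [s' [ps' ls' ws']] := reverse_path a s.
set b := last a s in ps' ls' ws' hmu.
have tab := gap_le a b t; have sab := gap_le a b s0.
case: Q => [|q Q] in ih hQ hQmu *.
  (* The last path is joined to both [t] and [s0]. Its two orientations have connections of total
     weight at least twice the gap, so the better one wins the full gap, half of which covers
     [mu / 2]. *)
  rewrite big_seq1 /= -/b cats0.
  case: (leP (weight t b + weight a s0) (weight t a + weight b s0)) => le_ab.
    exists (a :: s) => //=; rewrite -cats1 path_weight_cat /= -/b addr0.
    move: le_ab tab sab; rewrite (weight_sym s0 a) (weight_sym s0 b); lra.
  exists (b :: s') => //=; rewrite -cats1 path_weight_cat /= ls' ws' addr0.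
  move: le_ab tab sab; rewrite (weight_sym s0 a) (weight_sym s0 b); lra.
have nQ : q :: Q <> [::] by [].
rewrite big_cons /= -/b -[_ + _ + mu / 2]addrA.
case: (leP (weight t b) (weight t a)) => le_ab.
  have [H pH hH] := ih b nQ hQ hQmu.
  exists ((a :: s) ++ H); first by rewrite perm_cat2l.
  rewrite rcons_cat path_weight_cat /= -/b.
  move: hH; move: (\sum_(_ <- _) _) => X; lra.
have [H pH hH] := ih a nQ hQ hQmu.
exists ((b :: s') ++ H); first by rewrite (perm_cat ps').
rewrite rcons_cat path_weight_cat /= ls' ws'.
move: hH; move: (\sum_(_ <- _) _) => X; lra.
Qed.

Lemma pick_min (T : eqType) (f : T -> rat) (Q : seq T) : Q <> [::] ->
  exists q Q', perm_eq Q (q :: Q') /\ all (fun z => f q <= f z) Q'.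
Proof.
elim: Q => // q Q ih _; case: Q ih => [|z Q] ih; first by exists q, [::].
have [//|y [Q' [p h]]] := ih; case: (leP (f q) (f y)) => hq.
  exists q, (z :: Q); split=> //; rewrite (perm_all _ p) /= hq.
  by apply: sub_all h => w; apply: le_trans.
exists y, (q :: Q'); split; last by rewrite /= (ltW hq).
rewrite (perm_trans (_ : perm_eq _ (q :: y :: Q'))) ?perm_cons //.
exact/permPl/(perm_catCA [:: q] [:: y] Q').
Qed.

(** The path of least gap is laid first. It has no connection of its own; the extra [mu / 2] of
    [connect_paths], with [mu] its gap, pays its share. *)
Lemma join_paths Q : Q <> [::] -> uniq (flatten Q) ->
  all (fun q => 0 < size q)%N Q ->
  exists2 H, perm_eq H (flatten Q) &
    \sum_(q <- Q) (seq_weight q + gap q / 2) <= cycle_weight H.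
Proof.
move=> nQ uQ sQ; have [q [Q' [pQ hq]]] := pick_min gap nQ.
have pf : perm_eq (flatten Q) (q ++ flatten Q') by apply: (perm_flatten pQ).
rewrite (perm_uniq pf) in uQ; rewrite (perm_all _ pQ) /= in sQ.
rewrite (perm_big _ pQ) /= big_cons.
case: q sQ hq uQ pf {pQ} => // a s sQ hq uQ pf.
(* A single path is simply closed, which wins back its whole gap. *)
have [Q'0|/eqP Q'n] := eqVneq Q' [::].
  rewrite Q'0 big_nil cats0 addr0 in pf uQ *; exists (a :: s).
    by rewrite perm_sym.
  rewrite cycle_weight_cons //=; have := weight_ge0 (last a s) a; lra.
have [H pH hH] := connect_paths (last a s) a Q'n sQ hq.
have pH' : perm_eq ((a :: s) ++ H) ((a :: s) ++ flatten Q').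
  by rewrite perm_cat2l.
exists ((a :: s) ++ H).
  by rewrite (perm_trans pH') // perm_sym.
rewrite /= cycle_weight_cons; last by have := uQ; rewrite -(perm_uniq pH').
rewrite path_weight_cat last_cat -[in X in _ <= X]addrA.
have -> : path_weight (last a s) H + weight (last (last a s) H) a =
  path_weight (last a s) (rcons H a).
  by rewrite -cats1 path_weight_cat /= addr0.
move: hH; rewrite /=; move: (\sum_(_ <- _) _) => X; lra.
Qed.

(** Each cycle retains its weight minus half of its deleted edge, and that edge weighs at most a
    [k]-th of the cycle. *)
Lemma packing_to_cycle k P : (0 < k)%N -> P <> [::] ->
  all (k_cycle k) P -> uniq (flatten P) ->
  exists2 H, perm_eq H (flatten P) &
    (1 - (1 / 2) / k%:R) * packing_weight P <= cycle_weight H.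
Proof.
move=> k0 nP aP uP.
have [Q [sQ pQ nQ hQ]] : exists Q, [/\ size Q = size P,
    perm_eq (flatten Q) (flatten P), all (fun q => 0 < size q)%N Q &
    (1 - (1 / 2) / k%:R) * packing_weight P <=
    \sum_(q <- Q) (seq_weight q + gap q / 2)].
  rewrite /packing_weight; elim: P {nP} aP uP => [|c P ih] /=.
    by exists [::]; rewrite !big_nil mulr0.
  case/andP=> /and3P[_ uc /eqP sc] aP; rewrite cat_uniq => /and3P[_ _ uP].
  have [Q [sQ pQ nQ hQ]] := ih aP uP.
  have [|q [pq wq hq]] := lightest_edge uc; first by rewrite sc.
  exists (q :: Q); split=> /=.
  - by rewrite sQ.
  - by rewrite perm_cat.
  - by rewrite (perm_size pq) sc k0.
  rewrite !big_cons mulrDr lerD // wq; rewrite sc wq in hq.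
  have kn0 : (0 : rat) < k%:R by rewrite ltr0n.
  have : gap q <= (seq_weight q + gap q) / k%:R.
    by rewrite ler_pdivlMr // mulrC.
  rewrite mulrBl mul1r -mulrA [k%:R^-1 * _]mulrC; lra.
have nQ0 : Q <> [::] by move=> Q0; rewrite Q0 in sQ; case: (P) nP sQ.
have [|H pH hH] := join_paths nQ0 _ nQ; first by rewrite (perm_uniq pQ).
by exists H; [apply: perm_trans pQ | apply: le_trans hQ hH].
Qed.

End CycleWeight.

(** * The reduction *)

(** The cutting program also reads the tour, so its running time is polynomial in the instance only
    if the tour's encoding is. *)
Lemma size_enc_cycle n (c : seq 'I_n) :
  (tree_size (enc_cycle c) <= 1 + size c * (2 * n + 2))%N.
Proof.
have size_unary i : tree_size (enc_unary i) = (2 * i + 1)%N.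
  by elim: i => //= i ->; lia.
elim: c => [|x c ih] //=; rewrite size_unary.
by have := ltn_ord x; lia.
Qed.

Lemma nverts_le_size (G : metric_graph) :
  (nverts G <= tree_size (enc_graph G))%N.
Proof.
rewrite -{1}(size_enum_ord (nverts G)) /enc_graph.
have size_le T (enc : T -> tree) s : (size s <= tree_size (enc_seq enc s))%N.
  by elim: s => //= x s; lia.
exact: size_le.
Qed.

Lemma cut_packing k m n (c : seq 'I_n) : (3 <= k)%N -> n = (m * k)%N ->
  uniq c -> size c = n -> k_cycle_packing k (rev (cut k m c)).
Proof.
move=> k3 nE uc sc; have scE : size c = (m * k)%N by rewrite sc.
have pc : perm_eq (flatten (rev (cut k m c))) c.
  rewrite -{2}(flatten_cut scE); apply: perm_flatten.
  by rewrite perm_sym -perm_rev perm_refl.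
split.
- by rewrite size_rev size_reshape size_nseq nE mulnK //; lia.
- have uP : all uniq (rev (cut k m c)).
    have : uniq (flatten (rev (cut k m c))) by rewrite (perm_uniq pc).
    elim: (rev _) => //= d P ih; rewrite cat_uniq => /and3P[-> _ /ih ->].
    by [].
  have := all_size_cut scE; rewrite -all_rev => sP.
  rewrite /k_cycle k3; apply/allP => d dP /=.
  by rewrite (allP uP _ dP) (allP sP _ dP).
- by rewrite (perm_uniq pc).
- move=> x; rewrite (perm_mem pc).
  (* A repetition-free sequence of [n] vertices contains them all. *)
  have [||_ ->] := @uniq_min_size _ c (enum 'I_n) uc; last by rewrite mem_enum.
    by move=> y _; rewrite mem_enum.
  by rewrite size_enum_ord sc.
Qed.

Lemma paths_weight_le_packing (G : metric_graph)
    (P : seq (seq 'I_(nverts G))) :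
  uniq (flatten P) -> paths_weight P <= packing_weight P.
Proof.
rewrite /paths_weight /packing_weight.
elim: P => [|c P ih]; first by rewrite !big_nil.
rewrite /= cat_uniq !big_cons => /and3P[uc _ /ih]; apply: lerD.
exact: seq_weight_le_cycle.
Qed.

Lemma paths_weight_rev (G : metric_graph) (P : seq (seq 'I_(nverts G))) :
  paths_weight (rev P) = paths_weight P.
Proof. by apply: perm_big; rewrite perm_rev. Qed.

(** The best of the [k] offsets is at least their mean, which [sum_paths_weight_rot] evaluates;
    closing the paths adds only nonnegative weights. *)
Lemma best_cut (G : metric_graph) k (c : seq 'I_(nverts G)) :
  (3 <= k)%N -> (k %| nverts G)%N -> hamiltonian_cycle c ->
  exists P : seq (seq 'I_(nverts G)), [/\ k_cycle_packing k P,
    tree_hd (tbest k.-1 k (enc_graph G) (enc_cycle c)) = enc_packing P &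
    (1 - 1 / k%:R) * cycle_weight c <= packing_weight P].
Proof.
move=> k3 /dvdnP[m nE] /and3P[n3 uc /eqP sc].
have k0 : (0 < k)%N by lia.
have m0 : (0 < m)%N by move: n3; rewrite nE; case: (m).
have scE : size c = (m * k)%N by rewrite sc.
have lt_k : (k.-1 < size c)%N.
  by rewrite scE prednK // -{1}[k]mul1n leq_mul2r m0 orbT.
have [i [f [le_i e _ mx]]] := tbestP k0 scE lt_k.
have pk : k_cycle_packing k (rev (cut k m (rot i c))).
  by apply: cut_packing; rewrite ?rot_uniq ?size_rot.
exists (rev (cut k m (rot i c))); rewrite e; split=> //.
have [_ _ uP _] := pk; apply: le_trans (paths_weight_le_packing uP).
rewrite paths_weight_rev.
have kn0 : (0 : rat) < k%:R by rewrite ltr0n.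
rewrite -(ler_pM2l kn0).
have -> : k%:R * ((1 - 1 / k%:R) * cycle_weight c) = k.-1%:R * cycle_weight c.
  rewrite mulrA mulrBr mulr1 mulrC mul1r mulfV ?gt_eqF //.
  by rewrite -subn1 natrB // mulrC.
rewrite -(sum_paths_weight_rot uc m0 k0 scE).
set w := paths_weight _.
have -> : k%:R * w = \sum_(0 <= j < k) w.
  by rewrite sumr_const_nat subn0 mulr_natl.
apply: ler_sum_nat => j /= ltj; apply: mx; lia.
Qed.

Theorem mainTheorem1 (R : realType) (k : nat) (hk : (3 <= k)%N)
    (alpha : R) (halpha : 0 < alpha <= 1) :
  has_polytime_approx alpha metric_TSP ->
  has_polytime_approx
    (alpha * (1 - (1 / 2) / k%:R) * (1 - 1 / k%:R)) (metric_kCP k).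
Proof.
move=> [c [p hc]].
have k0 : (0 < k)%N by lia.
have [_ [cg [m [T [_ [b hT] hg]]]]] : ptime (fun d =>
    tree_hd (tbest k.-1 k (tree_hd d) (tree_tl d))).
  by apply: ptime_hd; apply: ptime_tbest => //; ptime.
(* [N] lies above all variables of [c] and keeps the graph while [c] runs. The outer test handles
   the empty graph, for which TSP guarantees nothing and the empty packing is right. *)
pose N := (cmd_bound c).+1.
pose prog := CIf (EVar 0)
  (CSeq (CAssign N (EVar 0)) (CSeq c
    (CSeq (CAssign 0 (ECons (EVar N) (EVar 0))) cg)))
  (CAssign 0 ENil).
(* The three terms pay for the connecting commands, the TSP run, and the cutting run on the pair of
   graph and tour. *)
pose U (d : tree) : nat := (10 + p.[tree_size d]%R +
  (tree_size d + (1 + tree_size d * (2 * tree_size d + 2)) + 2) ^ b)%N.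
have [|p' hp'] := @poly_bounded_polyP U.
  apply: poly_bounded_add; last by apply: poly_bounded_exp; poly_bound.
  apply: poly_bounded_add (poly_bounded_const _) (poly_bounded_horner _).
exists prog, p' => G /= kG.
have [n0|n0] := posnP (nverts G).
  exists [::], 4%N.
  have enc0 : enc_graph G = Leaf.
    rewrite /enc_graph; have : size (enum 'I_(nverts G)) = 0%N.
      by rewrite size_enum_ord.
    by move=> /size0nil ->.
  have noV : 'I_(nverts G) -> False by rewrite n0 => -[].
  split.
  - exists (update (init_store (enc_graph G)) 0 Leaf); split; last by [].
    rewrite enc0; apply: (@ExecIfFalse _ _ _ _ _ 2) => //.
    exact: (ExecAssign 0 ENil).
  - by apply: leq_trans (hp' _); rewrite /U; lia.
  - by split=> //; rewrite n0 div0n.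
  - move=> y' [sy' _ _ _].
    have {}sy' : size y' = 0%N by rewrite sy' n0 div0n.
    by rewrite (size0nil sy') /packing_weight big_nil raddf0 mulr0.
have n3 : (3 <= nverts G)%N by apply: leq_trans hk (dvdn_leq n0 kG).
have [H [t [[s1 [e1 s10]] le_t hamH bestH]]] := hc G n3.
have [P [packP encP valP]] := best_cut hk kG hamH.
exists P.
pose d := enc_graph G; pose s0 := init_store d.
pose s0' := update s0 N (s0 0).
(* The TSP run is replayed with the saved graph in variable [N]. *)
have [|s1' [e1' a1 f1]] := exec_frame (m := N) e1 (leqnSn _) (r := s0').
  by move=> x hx; rewrite /s0' updateE; case: eqP => // xN; lia.
pose s2 := update s1' 0 (Node (s1' N) (s1' 0)).
have s20 : s2 0 = Node d (enc_cycle H).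
  by rewrite /s2 updateE eqxx f1 // -a1 // s10 /s0' updateE eqxx.
have [s3 [t3 [e3 le3 s30 _]]] := hg s2; rewrite s20 in le3 s30.
exists (2 + (2 + (t + (4 + t3))))%N; split.
- exists s3; split; last by rewrite s30 /= encP.
  apply: ExecIfTrue.
    rewrite /= /init_store updateE eqxx /enc_graph.
    case e: (enum _) => [|//]; move/(congr1 size): e.
    by rewrite size_enum_ord /=; lia.
  apply: ExecSeq (ExecAssign N (EVar 0) s0) _.
  apply: ExecSeq e1' _.
  exact: ExecSeq (ExecAssign 0 (ECons (EVar N) (EVar 0)) s1') e3.
- apply: leq_trans (hp' _); rewrite /U -/d.
  suff : (t3 <=
      (tree_size d + (1 + tree_size d * (2 * tree_size d + 2)) + 2) ^ b)%N.
    by move: le_t => /=; rewrite -/d; lia.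
  apply: leq_trans le3 (leq_trans (hT _) _).
  case: (b) => // b'; rewrite leq_exp2r //=.
  have nd : (nverts G <= tree_size d)%N by apply: nverts_le_size.
  have /and3P[_ _ /eqP sH] := hamH.
  have := size_enc_cycle H; rewrite sH.
  have : (nverts G * (2 * nverts G + 2) <=
          tree_size d * (2 * tree_size d + 2))%N by apply: leq_mul; lia.
  by lia.
- exact: packP.
move=> P' [sP' cP' uP' covP'].
(* An arbitrary competing packing [P'] is turned into a Hamiltonian cycle [H'], against which the
   TSP guarantee for [H] applies. *)
have [|H' pH' hH'] := @packing_to_cycle G k P' k0 _ cP' uP'.
  move=> P'0; move: sP'; rewrite P'0 /= => /esym/eqP.
  by rewrite eqn0Ngt divn_gt0 // dvdn_leq.
have hamH' : hamiltonian_cycle H'.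
  rewrite /hamiltonian_cycle /k_cycle n3 (perm_uniq pH') uP' (perm_size pH') /=.
  have : perm_eq (flatten P') (enum 'I_(nverts G)).
    by apply: uniq_perm; rewrite ?enum_uniq // => x; rewrite covP' mem_enum.
  by move/perm_size ->; rewrite size_enum_ord.
have := bestH H' hamH'.
have al0 : 0 <= alpha by case/andP: halpha => /ltW.
have kR0 : (0 : R) < k%:R by rewrite ltr0n.
have ratr_k q : ratr (1 - q / k%:R) = 1 - ratr q / k%:R :> R.
  by rewrite rmorphB /= rmorph1 fmorph_div /= ratr_nat.
have : ratr ((1 - (1 / 2) / k%:R) * packing_weight P') <=
    ratr (cycle_weight H') :> R.
  by rewrite ler_rat.
have : ratr ((1 - 1 / k%:R) * cycle_weight H) <= ratr (packing_weight P) :> R.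
  by rewrite ler_rat.
rewrite !rmorphM /= !ratr_k fmorph_div /= rmorph1 ratr_nat => h1 h2 h3.
(* The cutting factor is nonnegative, so the TSP guarantee may be multiplied by it and chained with
   the bounds on [H'] and [P]. *)
have f0 : 0 <= 1 - 1 / k%:R :> R.
  by rewrite subr_ge0 ler_pdivrMr // mul1r ler1n.
apply: le_trans h1; rewrite mulrAC [X in X <= _]mulrC.
apply: (ler_wpM2l f0).
by apply: le_trans h3; rewrite -[X in X <= _]mulrA; apply: ler_wpM2l.
Qed.
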